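(* For all sufficiently large $n$, if $K\in\mathcal{K}(n,2,2)$ attains the maximum of $\mathfrak{q}_1$ over all complexes in $\mathcal{K}(n,2,2)$, then $K\cong \mathsf{T}_n^{2,2}$.
   Context: A simplicial complex is a family of subsets of a finite vertex set closed under taking subsets; an $i$-face is a member of cardinality $i+1$ and $S_i(K)$ is the set of $i$-faces. $K$ is pure $2$-dimensional if all facets are $2$-faces. $\mathcal{K}(n,2,2)$ is the set of pure $2$-dimensional complexes on $n$ vertices whose second Betti number $\dim H_2(K;\mathbb{R})$ equals $2$. For $f:S_1(K)\to\mathbb{R}$ and a $2$-face $F$, $f(\partial F)$ is the sum of $f$ over the three edges of $F$; $Q_1^{up}(K)$ is the operator on $\mathbb{R}^{S_1(K)}$ with $(Q_1^{up}(K)f)(G)=\sum_{F\in S_2(K):\,G\subset F}f(\partial F)$, and $\mathfrak{q}_1(K)$ is its largest eigenvalue. The tented complex $\mathsf{T}_n^2$ is the pure $2$-dimensional complex on $[n]$ whose facets are all $3$-subsets containing a fixed vertex $u$; $\mathsf{T}_n^{2,2}$ is obtained from $\mathsf{T}_n^2$ by adding two further $2$-faces (not containing $u$) that share a common edge. *)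

(* Defs.v *)
From mathcomp Require Import all_boot all_order all_algebra perm.
From mathcomp Require Import classical_sets reals.

Set Implicit Arguments.
Unset Strict Implicit.
Unset Printing Implicit Defensive.

Import Order.TTheory GRing.Theory Num.Theory.

Notation face K i := {F : {set _} | (F \in K) && (#|F| == i.+1)}.

Section Complexes.
Variable n : nat.
Implicit Types K L : {set {set 'I_n}}.

(* The empty set counts as a face (of dimension -1) of any nonvoid complex. *)
Definition simplicial_complex K : Prop :=
  forall F G : {set 'I_n}, F \in K -> G \subset F -> G \in K.

Definition on_all_vertices K : Prop := forall v : 'I_n, [set v] \in K.

Definition facet K (F : {set 'I_n}) : bool := maxset [in K] F.

Definition pure2 K : Prop := forall F, facet K F -> #|F| = 3.

Definition isomorphic K L : Prop :=
  exists s : {perm 'I_n}, forall F : {set 'I_n}, (s @: F \in L) = (F \in K).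

Definition tented (u : 'I_n) : {set {set 'I_n}} :=
  [set G : {set 'I_n} | [exists F : {set 'I_n}, [&& #|F| == 3, u \in F & G \subset F]]].

(* All edges of F1 and F2 already lie in the tented complex. The vertex u and
   the faces F1, F2 are arbitrary: all choices give isomorphic complexes. *)
Definition is_tented22 L : Prop :=
  exists (u : 'I_n) (F1 F2 : {set 'I_n}),
    [/\ #|F1| = 3 /\ #|F2| = 3,
        u \notin F1 /\ u \notin F2,
        #|F1 :&: F2| = 2
      & L = tented u :|: [set F1; F2]].

Local Open Scope ring_scope.

Section Operators.
Variables (R : realType) (K : {set {set 'I_n}}).

(* Chains and cochains are identified through the basis of faces. *)
Definition cochain (i : nat) := {ffun face K i -> R^o}.

(* The face F with increasing vertices v_0 < ... < v_(i+1) is sent to the sum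
   of (-1)^j (F minus v_j), and j is the number of vertices of F below v_j. *)
Definition boundary_fun (i : nat) (c : cochain i.+1) : cochain i :=
  [ffun G : face K i =>
    \sum_(F : face K i.+1) \sum_(v in val F | val F :\ v == val G)
      (-1) ^+ #|[set w in val F | (w < v)%N]| * (c F : R)].

Lemma boundary_fun_is_linear i : linear (@boundary_fun i).
Proof.
move=> a c d; apply/ffunP => G; rewrite !ffunE scaler_sumr -big_split /=.
apply: eq_bigr => F _; rewrite scaler_sumr -big_split /=.
by apply: eq_bigr => v _; rewrite !ffunE mulrDr; congr (_ + _); exact: mulrCA.
Qed.

Definition boundary (i : nat) : 'Hom(cochain i.+1, cochain i) :=
  linfun (@boundary_fun i).

Definition betti2 : nat :=
  (\dim (lker (boundary 1)) - \dim (limg (boundary 2)))%N.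

Definition on_boundary (f : cochain 1) (F : face K 2) : R :=
  \sum_(E : face K 1 | val E \subset val F) f E.

Definition Q1up_fun (f : cochain 1) : cochain 1 :=
  [ffun G : face K 1 =>
    \sum_(F : face K 2 | val G \subset val F) on_boundary f F].

Lemma Q1up_fun_is_linear : linear Q1up_fun.
Proof.
move=> a f g; apply/ffunP => G; rewrite !ffunE scaler_sumr -big_split /=.
apply: eq_bigr => F _; rewrite /on_boundary scaler_sumr -big_split /=.
by apply: eq_bigr => E _; rewrite !ffunE.
Qed.

Definition Q1up : 'End(cochain 1) := linfun Q1up_fun.

(* Q1up is symmetric, so as soon as K has an edge its set of eigenvalues is
   finite and nonempty and the supremum is the largest eigenvalue. *)
Definition q1 : R := sup [set a : R | passmx.leigenvalue Q1up a]%classic.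

End Operators.

Definition K22 (R : realType) K : Prop :=
  [/\ simplicial_complex K, on_all_vertices K, pure2 K & betti2 R K = 2%N].

End Complexes.

(* Main.v *)
(* The nonzero spectrum of Q1up is that of the operator on 2-faces with entries
   the numbers of common edges, so q1 has a Perron vector x >= 0 on the 2-faces.
   A test vector gives q1 > 2n - 3 for the tented complexes with two extra faces,
   hence for a maximizer K. Let abc be a face where x is maximal. Since the second
   Betti number is 2, tetrahedra and other small spheres in K are scarce; hence
   the eigenvalue equation at abc can only hold if almost every vertex z spans
   faces with exactly two edges of abc, both of value almost 1, and the sphere
   count forces the common vertex of these edges, say a, to be independent of z.
   Summing the eigenvalue equations over all faces through a, each missing face
   through a costs about n, while the Betti number bounds the faces avoiding a by
   the number of missing ones plus 2: so no face is missing, and K is the tented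
   complex with two extra faces. If these do not share an edge, moving one of
   them next to the other strictly increases the Rayleigh quotient of x. *)

From HB Require Import structures.
Require Import Defs.
From mathcomp Require Import boolp classical_sets topology normedtype derive.
From mathcomp Require Import all_boot all_order all_algebra fingroup perm.
From mathcomp Require Import zify ring lra.
From mathcomp Require Import reals.

Set Implicit Arguments.
Unset Strict Implicit.
Unset Printing Implicit Defensive.

Import Order.TTheory GRing.Theory Num.Theory numFieldNormedType.Exports.

Local Open Scope ring_scope.

(** The threshold 2n - 3 is what the constant vector gives on the bare tented complex: the edges of
    a face through the apex lie in n - 2, n - 2 and 1 faces. A maximizer is only known to exceed it,
    so estimates must be sharp in the leading term and may lose only a bounded amount. Scarcity of
    spheres fits this: for a fixed vertex set [W], each [z] completing a small sphere with [W] owns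
    a cycle with a face through [z] that the other cycles avoid, so there are at most two such [z].
    The obstacle is that at a face of maximal value such a [z] might contribute 3 instead of 2, and
    two of them could hide a vertex contributing 0. [tetra_sum] removes it: the equations of the
    four faces of a tetrahedron, added up, bound its total value by 3 + O(1/n), so an exceptional
    [z] exceeds 2 by O(1/n) only. In the final comparison, loss and gain are both quadratic in the
    values at the two extra faces, but the loss carries a factor O(1/n), because the values at faces
    through the apex are that close. *)

Lemma linear_coef_eq0 (R : realType) (a b : R) :
  (forall t, 0 <= a * t + b * t ^+ 2) -> a = 0.
Proof.
move=> H; apply/eqP; apply/negP => /negP a0.
have b1 : 0 < `|b| + 1 by rewrite ltr_wpDl.
have bb : b <= `|b| by exact: ler_norm.
(* A step short enough for the linear term to win: the + 1 keeps the denominator positive and the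
   factor b - |b| - 1 negative. *)
have := H (- a / (`|b| + 1)).
suff -> : a * (- a / (`|b| + 1)) + b * (- a / (`|b| + 1)) ^+ 2
   = (a / (`|b| + 1)) ^+ 2 * (b - `|b| - 1).
  have p : 0 < (a / (`|b| + 1)) ^+ 2.
    by rewrite exprn_even_gt0 //= mulf_neq0 // invr_eq0 gt_eqF.
  by rewrite pmulr_rge0 //; lra.
by field; rewrite gt_eqF.
Qed.

(** * The largest eigenvalue *)

Lemma sum_continuous (T : topologicalType) (R : realType) (I : finType)
    (F : I -> T -> R) :
  (forall i, continuous (F i)) -> continuous (fun x => \sum_i F i x).
Proof.
move=> cF; apply: continuous_big => // x.
exact: add_continuous.
Qed.

Lemma mul_continuous2 (T : topologicalType) (R : realType) (f g : T -> R) :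
  continuous f -> continuous g -> continuous (fun x => f x * g x).
Proof. by move=> cf cg x; apply: cvgM; [exact: cf|exact: cg]. Qed.

Definition quad (R : realType) (I : finType) (M : I -> I -> R) (g h : I -> R) :=
  \sum_i \sum_j g i * M i j * h j.

(** Functions on [I] are read as row vectors, where the unit sphere is closed and bounded, hence
    compact; [i0] makes it nonempty. *)
Lemma quad_max (R : realType) (I : finType) (i0 : I) (M : I -> I -> R) :
  exists f : I -> R, \sum_i f i ^+ 2 = 1 /\
    forall g : I -> R, \sum_i g i ^+ 2 = 1 -> quad M g g <= quad M f f.
Proof.
pose n := #|I|.
pose u (v : 'rV[R]_n) i := v ord0 (enum_rank i).
pose A := [set v : 'rV[R]_n | \sum_i u v i ^+ 2 = 1]%classic.
have uc i : continuous (fun v => u v i) by move=> v; exact: coord_continuous.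
have sc : continuous (fun v : 'rV[R]_n => \sum_i u v i ^+ 2).
  by apply: sum_continuous => i; exact: mul_continuous2.
have qc : continuous (fun v : 'rV[R]_n => quad M (u v) (u v)).
  apply: sum_continuous => i; apply: sum_continuous => j.
  apply: mul_continuous2 => //; apply: mul_continuous2 => //.
  exact: cst_continuous.
have ofun (g : I -> R) : u (\row_k g (enum_val k)) = g.
  by apply/funext => i; rewrite /u mxE enum_rankK.
have [|||c cA cmax] := @EVT_max_rV R n (fun v => quad M (u v) (u v)) A.
- exists (\row_k (enum_val k == i0)%:R); rewrite /A /= (ofun (fun i => (i == i0)%:R)).
  rewrite (bigD1 i0) //= eqxx big1 ?addr0 ?expr1n // => i /negPf ->.
  by rewrite expr0n.
- apply: bounded_closed_compact; last first.
    rewrite (_ : A = (fun v : 'rV[R]_n => \sum_i u v i ^+ 2) @^-1` [set 1])%classic //.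
    by apply: closed_comp => //; move=> ? _; exact: sc.
  exists 1; split => // x x1 v Av.
  rewrite /= [leLHS]/Num.norm /= mx_normrE.
  apply: bigmax_le => [|[i j] _ /=]; first exact: ltW (lt_trans ltr01 x1).
  apply: ltW; apply: le_lt_trans x1.
  rewrite -(expr_le1 (n := 2)) // real_normK ?num_real //.
  rewrite -Av (bigD1 (enum_val j)) //= /u enum_valK ord1 lerDl.
  by apply: sumr_ge0 => k _; exact: sqr_ge0.
- by apply: continuous_subspaceT.
exists (u c); split; first exact: set_mem cA.
move=> g g1; rewrite -(ofun g); apply: cmax.
by apply: mem_set; rewrite /A /= ofun.
Qed.

(** Taking absolute values cannot lower the form of a matrix with nonnegative entries, so a
    maximizer on the sphere may be chosen nonnegative; the eigenvalue equation is its first-order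
    condition. [M] may be reducible, so [f] may have zeros. *)
Theorem perron (R : realType) (I : finType) (i0 : I) (M : I -> I -> R) :
  (forall i j, M i j = M j i) -> (forall i j, 0 <= M i j) ->
  exists q (f : I -> R), [/\ forall i, 0 <= f i, exists i, 0 < f i,
    forall i, \sum_j M i j * f j = q * f i
  & forall g : I -> R, quad M g g <= q * \sum_i g i ^+ 2].
Proof.
move=> sM pM; have [f0 [f01 f0max]] := quad_max i0 M.
pose f i : R := `|f0 i|; pose q := quad M f0 f0.
have f1 : \sum_i f i ^+ 2 = 1.
  by rewrite -f01; apply: eq_bigr => i _; rewrite real_normK ?num_real.
have qf : quad M f f = q.
  apply/eqP; rewrite eq_le f0max //=; apply: ler_sum => i _; apply: ler_sum => j _.
  apply: le_trans (ler_norm _) _.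
  by rewrite !normrM (ger0_norm (pM i j)).
have ray g : quad M g g <= q * \sum_i g i ^+ 2.
  have [/eqP s0|s0] := boolP (\sum_i g i ^+ 2 == 0).
    have g0 i : g i = 0.
      apply/eqP; rewrite -sqrf_eq0; apply/eqP.
      by apply: (psumr_eq0P _ s0) => // j _; exact: sqr_ge0.
    rewrite s0 mulr0 /quad big1 // => i _; rewrite big1 // => j _.
    by rewrite g0 mul0r mul0r.
  have sp : 0 < \sum_i g i ^+ 2.
    by rewrite lt_def s0 sumr_ge0 // => i _; exact: sqr_ge0.
  set s := \sum_i g i ^+ 2 in s0 sp *.
  pose c := Num.sqrt s; have c2 : c ^+ 2 = s by rewrite sqr_sqrtr // ltW.
  have cn : c != 0 by rewrite -sqrf_eq0 c2.
  have /f0max : \sum_i (c^-1 * g i) ^+ 2 = 1.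
    under eq_bigr do rewrite exprMn.
    by rewrite -mulr_sumr exprVn c2 mulVf.
  have -> : quad M (fun i => c^-1 * g i) (fun i => c^-1 * g i) = s^-1 * quad M g g.
    rewrite /quad mulr_sumr; apply: eq_bigr => i _.
    rewrite mulr_sumr; apply: eq_bigr => j _; rewrite -c2; by field.
  by rewrite -/q mulrC ler_pdivrMr.
exists q, f; split => //.
- by move=> i; exact: normr_ge0.
- apply: contrapT => nex; have h := (forallNP _).2 nex.
  have : \sum_i f i ^+ 2 = 0.
    rewrite big1 // => i _; have /negP := h i; rewrite normr_gt0 negbK => /eqP e.
    by rewrite /f e normr0 expr0n.
  by rewrite f1 => /eqP; rewrite oner_eq0.
- move=> i; apply/eqP; rewrite -subr_eq0 -oppr_eq0.
  suff : 2 * - (\sum_j M i j * f j - q * f i) = 0.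
    by move/eqP; rewrite mulf_eq0 pnatr_eq0.
  (* Perturbing [f] by t at coordinate i, the slack in [ray] is -2t((Mf)_i - q f_i) + t^2 (q - M i
     i), since it is 0 at [f]. *)
  apply: (@linear_coef_eq0 _ _ (q - M i i)) => t.
  pose d j : R := (j == i)%:R.
  have := ray (fun j => f j + t * d j); rewrite -subr_ge0.
  have dl (h : I -> R) : \sum_j d j * h j = h i.
    rewrite (bigD1 i) //= /d eqxx mul1r big1 ?addr0 // => j /negPf ->.
    by rewrite mul0r.
  have -> : \sum_j (f j + t * d j) ^+ 2 = 1 + 2 * t * f i + t ^+ 2.
    transitivity (\sum_j (f j ^+ 2 + 2 * t * (d j * f j) + t ^+ 2 * (d j * d j))).
      by apply: eq_bigr => j _; ring.
    by rewrite !big_split /= f1 -!mulr_sumr !dl /d eqxx mulr1.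
  have -> : quad M (fun j => f j + t * d j) (fun j => f j + t * d j) =
     q + 2 * t * (\sum_j M i j * f j) + t ^+ 2 * M i i.
    rewrite -qf /quad.
    transitivity (\sum_k (\sum_j f k * M k j * f j + (t * f k) * M k i
       + d k * (t * \sum_j M k j * f j) + d k * (t ^+ 2 * M k i))).
      apply: eq_bigr => k _.
      transitivity (\sum_j (f k * M k j * f j + d j * (t * f k * M k j)
         + d k * t * (M k j * f j) + d j * (d k * t ^+ 2 * M k j))).
        by apply: eq_bigr => j _; ring.
      rewrite !big_split /= !dl -mulr_sumr; ring.
    rewrite !big_split /= !dl.
    have -> : \sum_k t * f k * M k i = t * \sum_j M i j * f j.
      by rewrite mulr_sumr; apply: eq_bigr => k _; rewrite (sM k); ring.
    ring.
  move=> H; apply: le_trans H _; rewrite le_eqVlt; apply/orP; left; apply/eqP; ring.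
Qed.

(** * From functions on edges to weights on 2-faces *)

Definition tri n (K : {set {set 'I_n}}) := [set F in K | #|F| == 3%N].

(** Weights live on all sets and vanish off [tri K], so no membership test is needed. On edges this
    is the transpose of [on_boundary]. *)
Definition star (R : realType) n (x : {set 'I_n} -> R) (E : {set 'I_n}) : R :=
  \sum_(F : {set 'I_n} | E \subset F) x F.

Lemma sum_face (R : realType) n (K : {set {set 'I_n}}) i (P : pred {set 'I_n})
    (h : {set 'I_n} -> R) :
  \sum_(F : face K i | P (val F)) h (val F) =
  \sum_(F : {set 'I_n} | [&& F \in K, #|F| == i.+1 & P F]) h F.
Proof.
rewrite [RHS](reindex_omap (val : face K i -> _) insub).
  apply: eq_bigl => -[F FK] /=; have /andP[-> ->] := FK.
  by rewrite insubT eqxx andbT.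
by move=> F /and3P[FK F3 _]; rewrite insubT ?FK ?F3.
Qed.

Section Spectrum.
Variables (R : realType) (n : nat) (K : {set {set 'I_n}}).

HB.instance Definition _ :=
  GRing.isLinear.Build _ _ _ _ (@Q1up_fun n R K) (@Q1up_fun_is_linear n R K).

Let M (G E : face K 1) : R :=
  \sum_(F : face K 2) ((val G \subset val F) && (val E \subset val F))%:R.

Lemma Q1upE (f : cochain R K 1) G : Q1up R K f G = \sum_E M G E * f E.
Proof.
rewrite /Q1up lfunE /= ffunE /on_boundary.
transitivity (\sum_(F : face K 2) \sum_(E : face K 1)
  ((val G \subset val F) && (val E \subset val F))%:R * (f E : R)).
  rewrite big_mkcond /=; apply: eq_bigr => F _; case: ifP => h.
    rewrite big_mkcond /=; apply: eq_bigr => E _.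
    by case: ifP; rewrite ?mul1r ?mul0r.
  by rewrite big1 // => E _; rewrite mul0r.
by rewrite exchange_big; apply: eq_bigr => E _; rewrite mulr_suml.
Qed.

(** [M] is the edge-face incidence matrix times its transpose. *)
Lemma quad_on_boundary (f : cochain R K 1) :
  quad M f f = \sum_(F : face K 2) (on_boundary f F) ^+ 2.
Proof.
rewrite /quad.
transitivity (\sum_(i : face K 1) \sum_(F : face K 2) \sum_(j : face K 1)
   ((val i \subset val F)%:R * (f i : R)) * ((val j \subset val F)%:R * (f j : R))).
  apply: eq_bigr => i _; rewrite exchange_big; apply: eq_bigr => j _.
  rewrite /M mulr_sumr mulr_suml; apply: eq_bigr => F _.
  case: (_ \subset _); case: (_ \subset _); rewrite /= ?mul0r ?mulr0 ?mul0r ?mul1r ?mulr1 //.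
rewrite exchange_big; apply: eq_bigr => F _.
have oE : on_boundary f F = \sum_(E : face K 1) (val E \subset val F)%:R * (f E : R).
  rewrite /on_boundary big_mkcond; apply: eq_bigr => E _.
  by case: ifP; rewrite ?mul1r ?mul0r.
rewrite expr2 {1}oE mulr_suml; apply: eq_bigr => i _.
by rewrite -mulr_sumr -oE.
Qed.

Lemma leigenvalueP (a : R) :
  reflect (exists2 f : cochain R K 1, f != 0 & Q1up R K f = a *: f)
    (passmx.leigenvalue (Q1up R K) a).
Proof.
rewrite /passmx.leigenvalue /passmx.leigenspace; apply: (iffP idP).
  move=> /eqP h; exists (vpick (lker (Q1up R K - a *: \1%VF))).
    by rewrite vpick0; apply/eqP.
  have := memv_pick (lker (Q1up R K - a *: \1%VF)).
  by rewrite memv_ker add_lfunE opp_lfunE scale_lfunE id_lfunE subr_eq0 => /eqP.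
case=> f f0 fa; apply/eqP => h.
have : f \in lker (Q1up R K - a *: \1%VF).
  by rewrite memv_ker add_lfunE opp_lfunE scale_lfunE id_lfunE subr_eq0 fa.
by rewrite h memv0 (negPf f0).
Qed.

(** The Perron value is an eigenvalue, and its Rayleigh bound at any other eigenvector caps that
    eigenvalue, so the supremum [q1] is attained there. *)
Lemma q1_edges (e : face K 1) : exists f : cochain R K 1,
  [/\ forall E, 0 <= f E :> R, f != 0, Q1up R K f = q1 R K *: f &
   forall g : cochain R K 1,
    \sum_(F : face K 2) (on_boundary g F) ^+ 2 <= q1 R K * \sum_E (g E : R) ^+ 2].
Proof.
have [||q [f [f0 [i fi] fq ray]]] := perron e (M := M).
- by move=> G E; apply: eq_bigr => F _; rewrite andbC.
- by move=> G E; apply: sumr_ge0 => F _; rewrite ler0n.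
pose f' : cochain R K 1 := [ffun E => f E].
have f'0 : f' != 0.
  by apply/eqP => /ffunP /(_ i); rewrite !ffunE => h; rewrite h ltxx in fi.
have f'q : Q1up R K f' = q *: f'.
  apply/ffunP => G; rewrite Q1upE !ffunE -[RHS]fq.
  by apply: eq_bigr => E _; rewrite ffunE.
suff -> : q1 R K = q.
  exists f'; split => // [E|g]; first by rewrite ffunE.
  by rewrite -quad_on_boundary; exact: ray.
have qin : [set a | passmx.leigenvalue (Q1up R K) a]%classic q.
  by apply/leigenvalueP; exists f'.
have qub : ubound [set a | passmx.leigenvalue (Q1up R K) a]%classic q.
  move=> a /leigenvalueP[g g0 ga].
  have := ray g.
  have -> : quad M g g = a * \sum_E (g E : R) ^+ 2.
    rewrite /quad mulr_sumr; apply: eq_bigr => G _.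
    under eq_bigr do rewrite -mulrA.
    rewrite -mulr_sumr -Q1upE ga ffunE expr2 mulrCA //.
  rewrite ler_pM2r // lt_def sumr_ge0 ?andbT; last by move=> ? _; exact: sqr_ge0.
  apply: contraNneq g0 => /psumr_eq0P h; apply/eqP/ffunP => E.
  apply/eqP; rewrite ffunE -sqrf_eq0; apply/eqP; apply: h => // ? _.
  exact: sqr_ge0.
apply/eqP; rewrite eq_le ge_sup //=; last by exists q.
by apply: ub_le_sup => //; exists q.
Qed.

Hypothesis sK : simplicial_complex K.
Variable e : face K 1.

Lemma q1_ge0 : 0 <= q1 R K.
Proof.
have [f [f0 fn0 _ ray]] := q1_edges e.
have := ray f; move=> /(le_trans _) h.
have := h 0; rewrite sumr_ge0 => [|F _]; last exact: sqr_ge0.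
move=> /(_ isT); rewrite pmulr_lge0 // lt_def sumr_ge0 ?andbT; last by move=> ? _; exact: sqr_ge0.
apply: contraNneq fn0 => /psumr_eq0P h'; apply/eqP/ffunP => E.
apply/eqP; rewrite ffunE -sqrf_eq0; apply/eqP; apply: h' => // ? _.
exact: sqr_ge0.
Qed.

(** Let [x F] be the sum of the edge Perron vector [f] over the edges of [F]. The equation for [f]
    then reads [star x E = q1 R K * f E], and [0 < q1 R K] keeps [x] from vanishing. *)
Lemma q1_perron : 0 < q1 R K -> exists x : {set 'I_n} -> R,
  [/\ forall F, 0 <= x F, forall F, F \notin tri K -> x F = 0,
      exists F, 0 < x F &
      forall F, F \in tri K ->
        q1 R K * x F = \sum_(E : {set 'I_n} | (#|E| == 2%N) && (E \subset F)) star x E].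
Proof.
move=> q0; have [f [f0 fn0 fq _]] := q1_edges e.
pose x (F : {set 'I_n}) : R :=
  if F \in tri K then \sum_(E : face K 1 | val E \subset F) (f E : R) else 0.
have starx (E : face K 1) : star x (val E) = q1 R K * (f E : R).
  have h : \sum_(F : face K 2 | val E \subset val F) on_boundary f F =
      q1 R K * (f E : R) :> R.
    have := congr1 (fun h : cochain R K 1 => h E : R) fq.
    by rewrite /Q1up lfunE /= !ffunE.
  rewrite -h.
  rewrite /star big_mkcond /=.
  transitivity (\sum_(F : face K 2 | val E \subset val F) x (val F)).
    rewrite (sum_face K 2 [pred F : {set 'I_n} | val E \subset F] x) [RHS]big_mkcond /=.
    apply: eq_bigr => F _; rewrite /x inE.
    by case: (F \in K); case: (#|F| == 3%N) => //=; case: ifP.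
  apply: eq_bigr => F _; rewrite /x inE; have /andP[-> ->] := valP F.
  by [].
have x0 F : 0 <= x F.
  by rewrite /x; case: ifP => // _; apply: sumr_ge0.
exists x; split => //.
- by move=> F /negPf h; rewrite /x h.
- apply: contrapT => h.
  have xz F : x F = 0.
    apply/eqP; apply: contra_notT h => h; exists F; by rewrite lt_def h x0.
  case/eqP: fn0; apply/ffunP => E; rewrite ffunE.
  apply/eqP; have : q1 R K * (f E : R) == 0.
    by rewrite -starx /star big1.
  by rewrite mulf_eq0 gt_eqF.
- move=> F FK; rewrite {1}/x FK mulr_sumr.
  under eq_bigr do rewrite -starx.
  rewrite (sum_face K 1 [pred E : {set 'I_n} | E \subset F] (star x)).
  apply: eq_bigl => E; rewrite /= andbA.
  case: (boolP (E \subset F)) => EF; rewrite ?andbF // !andbT.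
  by rewrite (sK _ EF) //; move: FK; rewrite inE => /andP[].
Qed.

(** With [g] = [star x], its squared norm [s] is also the pairing of [on_boundary g] with [x], and
    [ray] bounds the squared norm of [on_boundary g] by q s. Expanding the square of
    [on_boundary g - t x] gives [key]; t = q yields the claim. *)
Lemma q1_rayleigh (x : {set 'I_n} -> R) : (forall F, F \notin tri K -> x F = 0) ->
  \sum_(E : {set 'I_n} | #|E| == 2%N) (star x E) ^+ 2 <= q1 R K * \sum_F (x F) ^+ 2.
Proof.
move=> x0; set q := q1 R K; set s := \sum_(E | _) _; set X := \sum_F _.
have [_ [_ _ _ ray]] := q1_edges e.
pose g : cochain R K 1 := [ffun E => star x (val E)].
have starE0 (E : {set 'I_n}) : #|E| == 2%N -> E \notin K -> star x E = 0.
  move=> E2 EK; rewrite /star big1 // => F EF; apply: x0.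
  by apply: contra EK; rewrite inE => /andP[FK _]; apply: sK EF.
have sg : \sum_E (g E : R) ^+ 2 = s.
  under eq_bigr do rewrite ffunE.
  rewrite (sum_face K 1 xpredT (fun E => star x E ^+ 2)) /s [LHS]big_mkcond [RHS]big_mkcond /=.
  apply: eq_bigr => E _; rewrite andbT; case E2 : (#|E| == 2%N); rewrite ?andbF ?andbT //.
  by case: ifPn => // EK; rewrite starE0 // expr0n.
have gx : \sum_(F : face K 2) on_boundary g F * x (val F) = s.
  transitivity (\sum_(E : face K 1) (g E : R) * star x (val E)); last first.
    by rewrite -sg; apply: eq_bigr => E _; rewrite [in RHS]expr2 !ffunE.
  have sE (E : face K 1) : star x (val E) =
      \sum_(F : face K 2) (val E \subset val F)%:R * x (val F).
    rewrite (sum_face K 2 xpredT (fun F => (val E \subset F)%:R * x F)) /star.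
    rewrite big_mkcond [RHS]big_mkcond; apply: eq_bigr => F _.
    rewrite andbT; case: (boolP (F \in tri K)) => FK.
      by move: FK; rewrite inE => ->; case: ifP; rewrite ?mul1r ?mul0r.
    by rewrite x0 // mulr0; case: ifP; case: ifP.
  under [RHS]eq_bigr do rewrite sE mulr_sumr.
  rewrite exchange_big; apply: eq_bigr => F _.
  rewrite /on_boundary big_mkcond mulr_suml; apply: eq_bigr => E _.
  by case: ifP; rewrite ?mul0r ?mul1r ?mulr0.
have xx : \sum_(F : face K 2) x (val F) ^+ 2 = X.
  rewrite (sum_face K 2 xpredT (fun F => x F ^+ 2)) /X [LHS]big_mkcond; apply: eq_bigr => F _.
  rewrite andbT; case: ifPn => // FK; rewrite x0 ?expr0n // inE //.
have key t : 0 <= q * s - 2 * t * s + t ^+ 2 * X.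
  have : 0 <= \sum_(F : face K 2) (on_boundary g F - t * x (val F)) ^+ 2.
    by apply: sumr_ge0 => F _; exact: sqr_ge0.
  have -> : \sum_(F : face K 2) (on_boundary g F - t * x (val F)) ^+ 2 =
     \sum_(F : face K 2) on_boundary g F ^+ 2 - 2 * t * s + t ^+ 2 * X.
    rewrite -gx -xx !mulr_sumr -sumrN -!big_split /=.
    by apply: eq_bigr => F _; ring.
  move=> h; apply: le_trans h _; rewrite !lerD2r -sg; exact: ray.
(* For q = 0 the choice t = q says nothing; [key] for all t then forces s = 0. *)
have := q1_ge0; rewrite le_eqVlt => /orP[/eqP q0|qp].
  have : - 2 * s = 0.
    apply: (@linear_coef_eq0 _ _ X) => t; have := key t.
    by rewrite /q -q0 mul0r; congr (_ <= _); ring.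
  by rewrite /q -q0; lra.
have := key q; rewrite (_ : _ + _ = q * (q * X - s)); last by ring.
by rewrite pmulr_rge0 // subr_ge0.
Qed.

End Spectrum.

Lemma sum_indicator (R : pzSemiRingType) (T : finType) (A : {pred T}) :
  \sum_(z : T) (z \in A)%:R = #|A|%:R :> R.
Proof. by rewrite -sum1_card natr_sum [RHS]big_mkcond; apply: eq_bigr => z _; case: (z \in A). Qed.

(* The link of z contains a cycle of length 3 or 4 on vertices of W which is
   filled by faces of the complex: coned with z it becomes the boundary of a
   tetrahedron, resp. of a bipyramid with common triangle abz and apexes p, r. *)
Definition link_cycle n (k : 'I_n -> 'I_n -> 'I_n -> bool) (W : {set 'I_n}) z :=
  [exists a, exists b, exists c,
     [&& a \in W, b \in W, c \in W, k a b c, k a b z, k a c z & k b c z]]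
  || [exists a, exists b, exists p, exists r,
     [&& a \in W, b \in W, p \in W, r \in W, p != r,
         k a b p, k a b r, k a z p, k b z p, k a z r & k b z r]].

(** * Finding the apex *)

(* k a b c tells whether abc is a face and X is the Perron vector on faces,
   normalized to have maximum 1. Both vanish on degenerate triples, so that
   sums over a third vertex need no side condition. *)
Section Core.
Variables (R : realFieldType) (n : nat).
Implicit Types (a b c d v w y z : 'I_n).
Variables (k : 'I_n -> 'I_n -> 'I_n -> bool) (X : 'I_n -> 'I_n -> 'I_n -> R) (q : R).
Hypotheses (k12 : forall a b c, k a b c = k b a c)
  (k23 : forall a b c, k a b c = k a c b)
  (kd : forall a c, k a a c = false).
Hypotheses (X12 : forall a b c, X a b c = X b a c)
  (X23 : forall a b c, X a b c = X a c b)
  (X_ge0 : forall a b c, 0 <= X a b c)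
  (Xk : forall a b c, X a b c <= (k a b c)%:R).
Let N a b := \sum_z X a b z.
Hypothesis eig : forall a b c, k a b c -> q * X a b c = N a b + N a c + N b c.
Variable m : R.
Hypothesis mE : m = n%:R.
Hypothesis qm : 2 * m - 3 < q.
Hypothesis m_big : 1000 <= m.
Let Ex (W : {set 'I_n}) := [set z | (z \notin W) && link_cycle k W z].
Hypothesis card_Ex : forall W, (#|Ex W| <= 2)%N.

(** In [tetra_sum] the equations give at most 6m + 12, to be beaten by (2m - 3)(3 + e) = 6m - 9 +
    2me - 3e. So 2me must exceed 21 with a little to spare, and me = 11 does. *)
Let e : R := 11 / m.
Let me : m * e = 11. Proof.
have m0 : 0 < m by apply: lt_le_trans m_big.
by rewrite /e mulrC divfK // gt_eqF.
Qed.
Let e_lt : 0 < e < 1 / 50.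
Proof.
have mb := m_big; have m0 : 0 < m by lra.
by apply/andP; split; [rewrite divr_gt0 //; lra|rewrite ltr_pdivrMr //; lra].
Qed.

Ltac ksolve := first [ assumption | by rewrite k12 | by rewrite k23
  | by rewrite k12 k23 | by rewrite k23 k12 | by rewrite k12 k23 k12 ].

Lemma Xd a c : X a a c = 0.
Proof. by apply/eqP; rewrite eq_le X_ge0 andbT; have := Xk a a c; rewrite kd. Qed.
Lemma Xd' a c : X a c a = 0. Proof. by rewrite X23 Xd. Qed.
Lemma Xd'' a c : X c a a = 0. Proof. by rewrite X12 X23 Xd. Qed.
Lemma kd' a c : k a c a = false. Proof. by rewrite k23 kd. Qed.
Lemma kd'' a c : k c a a = false. Proof. by rewrite k12 k23 kd. Qed.
Lemma X_le1 a b c : X a b c <= 1.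
Proof. by apply: le_trans (Xk a b c) _; case: (k a b c). Qed.
Lemma k_of_X a b c : 0 < X a b c -> k a b c.
Proof. by have := Xk a b c; case: (k a b c) => //=; lra. Qed.
Lemma N_ge0 a b : 0 <= N a b. Proof. by apply: sumr_ge0. Qed.

Lemma kneq a b c : k a b c -> [/\ a != b, a != c & b != c].
Proof.
move=> h; split; apply/eqP => E; move: h; rewrite E ?kd //.
  by rewrite kd'.
by rewrite kd''.
Qed.

Lemma tetI (W : {set 'I_n}) a b c z : z \notin W -> a \in W -> b \in W -> c \in W ->
  k a b c -> k a b z -> k a c z -> k b c z -> z \in Ex W.
Proof.
move=> zW aW bW cW h1 h2 h3 h4; rewrite inE zW; apply/orP; left.
apply/existsP; exists a; apply/existsP; exists b; apply/existsP; exists c.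
by rewrite aW bW cW h1 h2 h3 h4.
Qed.

Lemma bipI (W : {set 'I_n}) a b p r z : z \notin W -> a \in W -> b \in W -> p \in W -> r \in W ->
  p != r -> k a b p -> k a b r -> k a z p -> k b z p -> k a z r -> k b z r -> z \in Ex W.
Proof.
move=> zW aW bW pW rW pr h1 h2 h3 h4 h5 h6; rewrite inE zW; apply/orP; right.
apply/existsP; exists a; apply/existsP; exists b; apply/existsP; exists p; apply/existsP; exists r.
by rewrite aW bW pW rW pr h1 h2 h3 h4 h5 h6.
Qed.

(** The share of the vertex [z] in the eigenvalue equation at the face abc. *)
Let s3 a b c z := X a b z + X a c z + X b c z.

Lemma eig_s3 a b c : k a b c -> q * X a b c = \sum_z s3 a b c z.
Proof. by move=> h; rewrite eig // /s3 !big_split. Qed.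

Lemma s3_le3 a b c z : s3 a b c z <= 3.
Proof. rewrite /s3; have := X_le1 a b z; have := X_le1 a c z; have := X_le1 b c z; lra. Qed.

Lemma s3_le2 a b c z : ~~ [&& k a b z, k a c z & k b c z] -> s3 a b c z <= 2.
Proof.
rewrite /s3; have := Xk a b z; have := Xk a c z; have := Xk b c z.
case: (k a b z); case: (k a c z); case: (k b c z) => //=; lra.
Qed.

(* For all but two z, the edges E of the tetrahedron such that E and z span a
   face form a forest, so at most three of the six values X E z are nonzero. *)
Lemma tetra_sum a b c d : k a b c -> k a b d -> k a c d -> k b c d ->
  X a b c + X a b d + X a c d + X b c d <= 3 + e.
Proof.
move=> abc abd acd bcd; set s := _ + X b c d.
have [ab ac bc] := kneq abc; have [_ ad bd] := kneq abd; have [_ _ cd] := kneq acd.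
pose W := [set a; b; c; d].
have [aW bW cW dW] : [/\ a \in W, b \in W, c \in W & d \in W].
  by rewrite !inE !eqxx ?orbT.
pose t z := X a b z + X a c z + X a d z + X b c z + X b d z + X c d z.
(* Each edge of the tetrahedron lies in two of its four faces. *)
have ts : q * s = 2 * \sum_z t z.
  rewrite /s !mulrDr !eig // /t !big_split /= -/(N a b) -/(N a c) -/(N a d).
  rewrite -/(N b c) -/(N b d) -/(N c d); ring.
have t6 z : t z <= 6.
  rewrite /t; have := X_le1 a b z; have := X_le1 a c z; have := X_le1 a d z.
  have := X_le1 b c z; have := X_le1 b d z; have := X_le1 c d z; lra.
have t3 z : z \notin Ex W -> t z <= 3.
  move=> zE; have [zW|zW] := boolP (z \in W).
    rewrite /t; have := X_le1 a b z; have := X_le1 a c z; have := X_le1 a d z.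
    have := X_le1 b c z; have := X_le1 b d z; have := X_le1 c d z.
    by move: zW; rewrite !inE -!orbA => /or4P[] /eqP ->; rewrite ?Xd ?Xd' ?Xd''; lra.
  (* [n1] to [n4] exclude the triangles, [n5] to [n7] the three 4-cycles, each filled by two faces
     along a diagonal. A graph on four vertices with none of these has at most three edges. *)
  have n1 : ~~ [&& k a b z, k a c z & k b c z].
    by apply: contra zE => /and3P[? ? ?]; apply: (tetI zW aW bW cW).
  have n2 : ~~ [&& k a b z, k a d z & k b d z].
    by apply: contra zE => /and3P[? ? ?]; apply: (tetI zW aW bW dW).
  have n3 : ~~ [&& k a c z, k a d z & k c d z].
    by apply: contra zE => /and3P[? ? ?]; apply: (tetI zW aW cW dW).
  have n4 : ~~ [&& k b c z, k b d z & k c d z].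
    by apply: contra zE => /and3P[? ? ?]; apply: (tetI zW bW cW dW).
  have n5 : ~~ [&& k a b z, k b c z, k c d z & k a d z].
    by apply: contra zE => /and4P[? ? ? ?]; apply: (bipI zW aW cW bW dW) => //; ksolve.
  have n6 : ~~ [&& k a c z, k b c z, k b d z & k a d z].
    by apply: contra zE => /and4P[? ? ? ?]; apply: (bipI zW aW bW cW dW) => //; ksolve.
  have n7 : ~~ [&& k a b z, k b d z, k c d z & k a c z].
    by apply: contra zE => /and4P[? ? ? ?]; apply: (bipI zW aW dW bW cW) => //; ksolve.
  rewrite /t; have := Xk a b z; have := Xk a c z; have := Xk a d z.
  have := Xk b c z; have := Xk b d z; have := Xk c d z.
  suff : (k a b z + k a c z + k a d z + k b c z + k b d z + k c d z <= 3)%N.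
    by rewrite -(ler_nat R) !natrD; lra.
  move: n1 n2 n3 n4 n5 n6 n7.
  case: (k a b z); case: (k a c z); case: (k a d z);
    by case: (k b c z); case: (k b d z); case: (k c d z).
have tsum : \sum_z t z <= 3 * m + 6.
  apply: (@le_trans _ _ (\sum_z (3 + 3 * (z \in Ex W)%:R))).
    apply: ler_sum => z _; case: (boolP (z \in Ex W)) => h /=; last by have := t3 _ h; lra.
    by have := t6 z; lra.
  rewrite big_split /= sumr_const card_ord -mulr_sumr sum_indicator -[_ *+ n]mulr_natr.
  have : #|Ex W|%:R <= 2 :> R by rewrite ler_nat.
  rewrite -mE; lra.
have mb := m_big; have qb := qm; have ? := me; have /andP[e0 e1] := e_lt.
have q0 : 0 < q by lra.
rewrite -(ler_pM2l q0) ts.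
have h : (2 * m - 3) * (3 + e) <= q * (3 + e) by rewrite ler_wpM2r //; lra.
have : (2 * m - 3) * (3 + e) = 6 * m - 9 + 2 * (m * e) - 3 * e by ring.
rewrite me; lra.
Qed.

(* A vertex contributes at most 2 to q = q * X a b c > 2n - 3 unless it spans a
   tetrahedron with abc, which happens at most twice: none contributes much less. *)
Lemma near_max a b c z : k a b c -> X a b c = 1 -> z \notin [set a; b; c] ->
  2 - 2 * e <= s3 a b c z.
Proof.
move=> abc X1 zW; have qb := qm; have ? := me; have /andP[e0 e1] := e_lt.
pose W := [set a; b; c].
have [aW bW cW] : [/\ a \in W, b \in W & c \in W] by rewrite !inE !eqxx ?orbT.
have [ab ac bc] := kneq abc.
(* Excess over 2. The vertices a, b, c contribute at most 1 each, and this loss of 3 is exactly the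
   -3 in the lower bound for [q]: the total excess is q - 2m + 3 > 0. *)
pose g y := s3 a b c y - 2 + (y \in W)%:R.
have gs : 0 < \sum_y g y.
  rewrite /g big_split /= big_split /= -eig_s3 // X1 sum_indicator sumr_const card_ord.
  have -> : #|W| = 3%N.
    by rewrite /W -setUA cardsU1 cards2 !inE negb_or ab ac bc.
  rewrite -[_ *+ n]mulr_natr -mE; lra.
have gE y : g y <= e * (y \in Ex W)%:R.
  case: (boolP (y \in Ex W)) => yE.
    move: (yE); rewrite /g inE => /andP[/negPf -> _].
    have [/and3P[aby acy bcy]|t] := boolP [&& k a b y, k a c y & k b c y].
      by have := tetra_sum abc aby acy bcy; rewrite X1 /s3 /=; lra.
    by have := s3_le2 t; rewrite /=; lra.
  rewrite mulr0 /g; have [yW|yW] /= := boolP (y \in W).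
    rewrite /s3; have := X_le1 a b y; have := X_le1 a c y; have := X_le1 b c y.
    by move: yW; rewrite !inE -!orbA => /or3P[] /eqP ->; rewrite ?Xd ?Xd' ?Xd''; lra.
  suff : s3 a b c y <= 2 by lra.
  apply: s3_le2; apply: contra yE => /and3P[*]; exact: (tetI yW aW bW cW).
have : \sum_(y | y != z) g y <= 2 * e.
  apply: (@le_trans _ _ (\sum_y e * (y \in Ex W)%:R)).
    rewrite big_mkcond; apply: ler_sum => y _; case: ifP => // _.
    by rewrite mulr_ge0 // ltW.
  rewrite -mulr_sumr sum_indicator mulrC ler_wpM2r ?ler_nat //; exact: ltW.
have gz : g z = s3 a b c z - 2 by rewrite /g (negPf zW) addr0.
by move: gs; rewrite (bigD1 z) //= gz; lra.
Qed.

Let cone a b c := [set z | (z \notin [set a; b; c]) && (k a b z && k a c z)].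

(* If y does not lie in the cone, the face bcy has almost maximal value, hence
   almost all z satisfy byz and cyz; with z in the cone this closes a bipyramid. *)
Lemma cone_small a b c y : k a b c -> X a b c = 1 -> y \notin [set a; b; c] ->
  ~~ (k a b y && k a c y) -> #|cone a b c|%:R <= 60 :> R.
Proof.
move=> abc X1 yW nA; have mb := m_big; have qb := qm; have ? := me; have /andP[e0 e1] := e_lt.
have := near_max abc X1 yW; rewrite /s3 => sy.
have bcyX : 1 - 2 * e <= X b c y.
  have := Xk a b y; have := Xk a c y; have := X_le1 a b y; have := X_le1 a c y.
  by move: nA; case: (k a b y); case: (k a c y) => //=; lra.
have bcy : k b c y by apply: k_of_X; lra.
pose W := [set a; b; c; y].
have [aW bW cW yW'] : [/\ a \in W, b \in W, c \in W & y \in W].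
  by rewrite !inE !eqxx ?orbT.
have ay : y != a by move: yW; rewrite !inE !negb_or => /andP[/andP[]].
have aA : a \notin cone a b c by rewrite !inE eqxx.
(* Off [Ex W], a [z] in the cone spans a face with at most one edge of bcy: bcz would close a
   tetrahedron, byz and cyz together a bipyramid. Only z = a may reach 3. *)
have bound z : s3 b c y z <= 2 - (z \in cone a b c)%:R + 3 * (z \in Ex W)%:R + (z == a)%:R.
  have h3 := s3_le3 b c y z.
  case: (boolP (z \in Ex W)) => zE /=.
    by case: (z \in cone a b c); case: (z == a) => /=; lra.
  have [za|za] := eqVneq z a.
    by rewrite za (negPf aA) /=; move: h3; rewrite za; lra.
  have [zA|zA] := boolP (z \in cone a b c); last first.
    have [t|t] := boolP [&& k b c z, k b y z & k c y z]; last by have := s3_le2 t; lra.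
    have /and3P[t1 t2 t3] := t.
    have [_ bz cz] := kneq t1; have [_ _ yz] := kneq t2.
    have zW : z \notin W by rewrite !inE !negb_or za (eq_sym z b) bz (eq_sym z c) cz (eq_sym z y).
    by case/negP: zE; apply: (tetI zW bW cW yW').
  have zy : z != y by apply: contraNneq nA => <-; move: zA; rewrite inE => /andP[].
  have zW : z \notin W.
    by move: zA; rewrite !inE !negb_or => /andP[/andP[/andP[-> ->] ->] _].
  move: zA; rewrite inE => /and3P[_ abz acz].
  have n1 : ~~ k b c z by apply: contra zE => bcz; apply: (tetI zW aW bW cW).
  have n2 : ~~ (k b y z && k c y z).
    apply: contra zE => /andP[byz cyz].
    by apply: (bipI zW bW cW yW' aW) => //; ksolve.
  rewrite /s3; have := Xk b c z; have := Xk b y z; have := Xk c y z.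
  have := X_le1 b y z; have := X_le1 c y z.
  by move: n1 n2; case: (k b c z); case: (k b y z); case: (k c y z) => //=; lra.
have : q * X b c y <= 2 * m - #|cone a b c|%:R + 6 + 1.
  rewrite eig_s3 //.
  apply: le_trans (ler_sum _ (fun z _ => bound z)) _.
  rewrite !big_split /= sumr_const card_ord sumrN -mulr_sumr.
  rewrite (_ : \sum_z (z == a)%:R = 1 :> R); last first.
    by rewrite (bigD1 a) //= eqxx big1 ?addr0 // => z /negPf ->.
  rewrite !sum_indicator.
  have : #|Ex W|%:R <= 2 :> R by rewrite ler_nat.
  by rewrite -[_ *+ n]mulr_natr -mE; lra.
(* The left side is 2m - 3 - 44 + 6e, so the cone has at most 7 + 3 + 44 = 54 vertices; 60 leaves
   room. *)
have : (2 * m - 3) * (1 - 2 * e) <= q * X b c y.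
  by apply: ler_pM; lra.
have -> : (2 * m - 3) * (1 - 2 * e) = 2 * m - 3 - 4 * (m * e) + 6 * e by ring.
rewrite me; lra.
Qed.

(** By [near_max] every vertex off abc spans faces with two of its edges, hence lies in one of three
    cones. Not all three can have at most 60 vertices, and by [cone_small] a larger one omits no
    vertex. *)
Lemma max_face_apex a b c : k a b c -> X a b c = 1 ->
  exists a' b' c', [/\ k a' b' c', X a' b' c' = 1 &
    forall y, y \notin [set a'; b'; c'] -> k a' b' y && k a' c' y].
Proof.
move=> abc X1.
have mb := m_big; have /andP[e0 e1] := e_lt.
have large a' b' c' : k a' b' c' -> X a' b' c' = 1 -> 60 < #|cone a' b' c'|%:R :> R ->
    forall y, y \notin [set a'; b'; c'] -> k a' b' y && k a' c' y.
  move=> h1 h2 big y yW; apply: contraTT big => nA; rewrite -leNgt.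
  exact: cone_small yW nA.
have [h|ha] := boolP (60 < #|cone a b c|%:R :> R).
  by exists a, b, c; split => //; exact: large.
have [h|hb] := boolP (60 < #|cone b a c|%:R :> R).
  have bac : k b a c by rewrite k12.
  by exists b, a, c; split => //; [rewrite X12|apply: large => //; rewrite X12].
have [h|hc] := boolP (60 < #|cone c a b|%:R :> R).
  have cab : k c a b by ksolve.
  have X1' : X c a b = 1 by rewrite X12 X23.
  by exists c, a, b; split => //; exact: large.
have cover z : 1 <= (z \in [set a; b; c])%:R + (z \in cone a b c)%:R
    + (z \in cone b a c)%:R + (z \in cone c a b)%:R :> R.
  have [zW|zW] := boolP (z \in [set a; b; c]).
    by case: (z \in cone a b c); case: (z \in cone b a c); case: (z \in cone c a b) => /=; lra.
  have := near_max abc X1 zW; rewrite /s3.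
  have := Xk a b z; have := Xk a c z; have := Xk b c z.
  have := X_le1 a b z; have := X_le1 a c z; have := X_le1 b c z.
  move: zW; rewrite !inE !negb_or => /andP[/andP[-> ->] ->] /=.
  rewrite (k12 b a) (k12 c a) (k12 c b).
  by case: (k a b z); case: (k a c z); case: (k b c z) => /=; lra.
have : \sum_(z : 'I_n) (1 : R) <= #|[set a; b; c]|%:R + #|cone a b c|%:R
    + #|cone b a c|%:R + #|cone c a b|%:R.
  apply: le_trans (ler_sum _ (fun z _ => cover z)) _.
  by rewrite !big_split /= !sum_indicator.
have : #|[set a; b; c]|%:R <= 3 :> R.
  by rewrite ler_nat -setUA cardsU1 cards2; case: (a \notin _); case: (_ != _).
move: ha hb hc; rewrite -!leNgt sumr_const card_ord -mE; lra.
Qed.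

(** Add the equations at abz and acz, whose values sum to almost 2 because bcz is absent: the left
    side is about 4m. For all but two y, at most one of azy, bzy, czy is a face, so y contributes at
    most 3 + X a z y. Thus [N a z] must supply about m; 100 absorbs the bounded errors. *)
Lemma spoke_large a b c z : k a b c -> X a b c = 1 ->
  (forall y, y \notin [set a; b; c] -> k a b y && k a c y) ->
  z \notin [set a; b; c] -> ~~ k b c z -> m - 100 <= N a z.
Proof.
move=> abc X1 full zW nbcz.
have sz := near_max abc X1 zW; have /andP[abz acz] := full z zW.
pose W := [set a; b; c; z].
have [aW bW cW zW'] : [/\ a \in W, b \in W, c \in W & z \in W].
  by rewrite !inE !eqxx ?orbT.
have [_ _ bc] := kneq abc.
pose t y := X a b y + X a c y + 2 * X a z y + X b z y + X c z y.
have bound y : t y <= 3 + X a z y + 3 * (y \in Ex W)%:R.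
  rewrite /t.
  have := X_le1 a b y; have := X_le1 a c y; have := X_le1 a z y.
  have := X_le1 b z y; have := X_le1 c z y; have := X_ge0 a z y.
  have [yE|yE] := boolP (y \in Ex W); first by rewrite /=; lra.
  have [yW|yW] := boolP (y \in W).
    by move: yW; rewrite !inE -!orbA => /or4P[] /eqP ->; rewrite ?Xd ?Xd' ?Xd'' /=; lra.
  have /full/andP[aby acy] : y \notin [set a; b; c].
    by apply: contra yW; rewrite !inE => ->.
  have n1 : ~~ (k a z y && k b z y).
    by apply: contra yE => /andP[? ?]; apply: (tetI yW aW bW zW').
  have n2 : ~~ (k a z y && k c z y).
    by apply: contra yE => /andP[? ?]; apply: (tetI yW aW cW zW').
  have n3 : ~~ (k b z y && k c z y).
    by apply: contra yE => /andP[? ?]; apply: (bipI yW aW zW' bW cW) => //; ksolve.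
  have := Xk a z y; have := Xk b z y; have := Xk c z y.
  by move: n1 n2 n3; case: (k a z y); case: (k b z y); case: (k c z y) => //=; lra.
have : q * (X a b z + X a c z) <= 3 * m + N a z + 6.
  rewrite mulrDr !eig // (_ : N a b + N a z + N b z + _ = \sum_y t y); last first.
    by rewrite /t !big_split /= -mulr_sumr -/(N a b) -/(N a c) -/(N a z) -/(N b z) -/(N c z); ring.
  apply: le_trans (ler_sum _ (fun z _ => bound z)) _.
  rewrite !big_split /= sumr_const card_ord -mulr_sumr sum_indicator.
  have : #|Ex W|%:R <= 2 :> R by rewrite ler_nat.
  by rewrite -[_ *+ n]mulr_natr -mE -/(N a z); lra.
have mb := m_big; have qb := qm; have ? := me; have /andP[e0 e1] := e_lt.
have : (2 * m - 3) * (2 - 2 * e) <= q * (X a b z + X a c z).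
  apply: ler_pM; rewrite ?subr_ge0; try lra.
  by move: sz; rewrite /s3; have := Xk b c z; rewrite (negPf nbcz) /=; lra.
have -> : (2 * m - 3) * (2 - 2 * e) = 4 * m - 6 - 4 * (m * e) + 6 * e by ring.
rewrite me; lra.
Qed.

(** Ordered tuples are counted: a missing face gives two pairs here, a face avoiding [a] six triples
    in [ext]. *)
Let miss a v w := [&& v != w, v != a, w != a & ~~ k a v w].
Let ext a v w z := [&& v != a, w != a, z != a & k v w z].

(* Summing the eigenvalue equations over all faces through a: each absent face
   avw costs N a v + N a w, while only faces avoiding a can compensate. *)
Lemma loss_le_gain a :
  2 * \sum_v N a v * (\sum_w (miss a v w)%:R) <=
  \sum_v \sum_w \sum_z (ext a v w z)%:R.
Proof.
set G := \sum_v \sum_w _; set L := \sum_v _.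
pose S := \sum_v N a v.
have S0 : 0 <= S by apply: sumr_ge0 => v _; exact: N_ge0.
have qb := qm.
have Naa : N a a = 0 by rewrite /N big1 // => z _; rewrite Xd.
have deg v : v != a -> \sum_w (k a v w)%:R = m - 2 - \sum_w (miss a v w)%:R :> R.
  move=> va; apply/eqP; rewrite eq_sym subr_eq -big_split /= subr_eq; apply/eqP.
  transitivity (\sum_(w : 'I_n) (1 : R)).
    by rewrite sumr_const card_ord mE.
  transitivity (\sum_w ((k a v w)%:R + (miss a v w)%:R + (w == v)%:R + (w == a)%:R : R)).
    apply: eq_bigr => w _; rewrite /miss va (eq_sym v) /=.
    have [->|wv] := eqVneq w v; first by rewrite kd'' (negPf va) /= !add0r addr0.
    have [->|wa] := eqVneq w a; first by rewrite kd' /= !add0r.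
    by case: (k a v w); rewrite /= !addr0 // add0r.
  have one (u : 'I_n) : \sum_w (w == u)%:R = 1 :> R.
    by rewrite (bigD1 u) //= eqxx big1 ?addr0 // => w /negPf ->.
  by rewrite 2!big_split /= !one -addrA.
have half : \sum_v \sum_w (k a v w)%:R * N a v = (m - 2) * S - L.
  rewrite /S /L mulr_sumr -sumrB; apply: eq_bigr => v _.
  rewrite -mulr_suml; have [->|va] := eqVneq v a; first by rewrite Naa !mulr0 mul0r subrr.
  by rewrite deg //; ring.
have half' : \sum_v \sum_w (k a v w)%:R * N a w = (m - 2) * S - L.
  rewrite exchange_big -half /=; apply: eq_bigr => v _; apply: eq_bigr => w _.
  by rewrite k23.
(* In [N v w] the term at [a] is X a v w, which sums to at most [S]; the other terms are values of
   faces avoiding [a]. *)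
have rest : \sum_v \sum_w (k a v w)%:R * N v w <= S + G.
  rewrite /S /G -big_split /=; apply: ler_sum => v _.
  rewrite /N -big_split /=; apply: ler_sum => w _.
  case avw : (k a v w); last first.
    by rewrite mul0r addr_ge0 ?X_ge0 // sumr_ge0 // => z _; rewrite ler0n.
  have [av aw _] := kneq avw.
  have avE : X v w a = X a v w by rewrite [RHS]X12 X23.
  rewrite mul1r (bigD1 a) //= avE lerD2l.
  rewrite [X in _ <= X](bigD1 a) //= /ext eqxx !andbF add0r.
  apply: ler_sum => z za; rewrite (eq_sym v) av (eq_sym w) aw za; exact: Xk.
(* Since 2(m - 2) + 1 = 2m - 3 < q, the multiples of [S] drop out and 2 L <= G remains. *)
have : q * S <= (m - 2) * S - L + ((m - 2) * S - L) + (S + G).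
  apply: le_trans (lerD (lexx _) rest).
  rewrite -{1}half -half' -!big_split /= /S mulr_sumr le_eqVlt; apply/orP; left.
  apply/eqP; apply: eq_bigr => v _; rewrite -!big_split /= /N mulr_sumr.
  apply: eq_bigr => w _; rewrite -/(N a v) -/(N a w) -/(N v w).
  case avw : (k a v w); first by rewrite eig // !mul1r.
  have := Xk a v w; have := X_ge0 a v w; rewrite avw /= => x0 x1.
  by rewrite !mul0r !addr0 (_ : X a v w = 0) ?mulr0 //; lra.
have : 0 <= (q - 2 * m + 3) * S by apply: mulr_ge0 => //; lra.
rewrite (_ : (q - 2 * m + 3) * S = q * S - 2 * m * S + 3 * S); last by ring.
rewrite (_ : (m - 2) * S = m * S - 2 * S); last by ring.
rewrite -[2 * m * S]mulrA; lra.
Qed.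

(* Constants are crude: 27 bounds the number of ordered triples in a 3-set. *)
Hypothesis few_ext : forall a, \sum_v \sum_w \sum_z (ext a v w z)%:R <=
   27 * (\sum_v \sum_w (miss a v w)%:R + 2) :> R.
Hypothesis max1 : exists a b c, k a b c && (X a b c == 1).

(** By [loss_le_gain] and [few_ext], twice the sum of [N a v] over missing pairs is at most 27 per
    pair plus 54. This fails if [N a v] is large: it is nearly m at regular v, and at least 200 at
    irregular v when no missing pair has a regular entry. *)
Theorem exists_apex : exists a, forall v w, v != w -> v != a -> w != a -> k a v w.
Proof.
have mb := m_big; have qb := qm; have /andP[e0 e1] := e_lt.
have [a0 [b0 [c0 /andP[h1 /eqP h2]]]] := max1.
have [a [b [c [abc X1 full]]]] := max_face_apex h1 h2.
have [ab ac bc] := kneq abc.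
exists a => v0 w0 vw va wa; apply: contraT => nk0.
have miss0 : miss a v0 w0 by rewrite /miss vw va wa.
(* Irregular vertices close a tetrahedron with abc, so there are at most two; [spoke_large] applies
   to the regular ones. *)
pose irr v := k b c v && (v != a); pose reg v := (v \notin [set a; b; c]) && ~~ k b c v.
have spoke v : v != a -> v != b -> k a b v.
  move=> va' vb; have [->//|vc] := eqVneq v c.
  by have /full/andP[] : v \notin [set a; b; c] by rewrite !inE !negb_or va' vb vc.
have spoke' v : v != a -> v != c -> k a c v.
  move=> va' vc; have [->//|vb] := eqVneq v b; first by rewrite k23.
  by have /full/andP[] : v \notin [set a; b; c] by rewrite !inE !negb_or va' vb vc.
have missS v w : miss a v w = miss a w v.
  by rewrite /miss (k23 a v) (eq_sym v); case: (w != v); case: (v != a); case: (w != a).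
have missout v w : miss a v w -> reg v || irr v.
  move=> /and4P[vw' va' wa' nk]; rewrite /reg /irr va' andbT !inE !negb_or va' /=.
  have -> : v != b.
    by apply: contraNneq nk => vb; rewrite vb spoke // eq_sym -vb.
  have -> : v != c.
    by apply: contraNneq nk => vc; rewrite vc spoke' // eq_sym -vc.
  by case: (k b c v).
have irr2 : \sum_v (irr v)%:R <= 2 :> R.
  apply: (@le_trans _ _ (#|Ex [set a; b; c]|%:R)); last by rewrite ler_nat.
  rewrite -sum_indicator; apply: ler_sum => v _; rewrite ler_nat.
  case: (boolP (irr v)) => // /andP[bcv va'].
  have [_ bv cv] := kneq bcv.
  suff -> : v \in Ex [set a; b; c] by [].
  apply: (@tetI _ a b c v); rewrite ?inE ?eqxx ?orbT //.
  - by rewrite !negb_or va' (eq_sym v) bv (eq_sym v) cv.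
  - by apply: spoke => //; rewrite eq_sym.
  - by apply: spoke' => //; rewrite eq_sym.
pose P : R := \sum_v \sum_w (miss a v w)%:R.
have LG := le_trans (loss_le_gain a) (few_ext a); rewrite -/P in LG.
pose Rg : R := \sum_v \sum_w (miss a v w && reg v)%:R.
have regL v : reg v -> m - 100 <= N a v.
  by move=> /andP[v1 v2]; exact: (spoke_large abc).
have natge0 (B : bool) : 0 <= B%:R :> R by rewrite ler0n.
have P1 : 1 <= P.
  rewrite /P (bigD1 v0) //= (bigD1 w0) //= miss0 -addrA lerDl.
  by apply: addr_ge0; apply: sumr_ge0 => v _; rewrite ?sumr_ge0.
have [h|h] := boolP [exists v, exists w, miss a v w && reg v].
  have R1 : 1 <= Rg.
    have /existsP[v /existsP[w vw1]] := h.
    rewrite /Rg (bigD1 v) //= (bigD1 w) //= vw1 -addrA lerDl.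
    by apply: addr_ge0; apply: sumr_ge0 => ? _; rewrite ?sumr_ge0.
  (* A missing pair has a regular first entry, a regular second entry, or two irregular entries; the
     last kind occurs at most 2 * 2 times. *)
  have PR : P <= 2 * Rg + 4.
    have -> : 2 * Rg = Rg + \sum_v \sum_w (miss a v w && reg w)%:R.
      rewrite exchange_big /= mulr_natl mulr2n; congr (_ + _).
      by apply: eq_bigr => v _; apply: eq_bigr => w _; rewrite missS.
    apply: (@le_trans _ _ (\sum_v \sum_w ((miss a v w && reg v)%:R +
        (miss a v w && reg w)%:R + (irr v)%:R * (irr w)%:R))).
      apply: ler_sum => v _; apply: ler_sum => w _.
      case mvw : (miss a v w); rewrite /= ?add0r ?mulr_ge0 //.
      have := missout _ _ mvw; rewrite missS in mvw; have := missout _ _ mvw.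
      case: (reg v); case: (reg w); case: (irr v); case: (irr w) => //= _ _; lra.
    under eq_bigr do rewrite 2!big_split /=.
    rewrite 2!big_split /= lerD2l.
    under eq_bigr do rewrite -mulr_sumr.
    rewrite -mulr_suml; have := irr2; have : 0 <= \sum_v (irr v)%:R :> R by apply: sumr_ge0.
    move=> *; rewrite (_ : 4 = 2 * 2 :> R); last by ring.
    by apply: ler_pM.
  have : (m - 100) * Rg <= \sum_v N a v * \sum_w (miss a v w)%:R.
    rewrite /Rg mulr_sumr; apply: ler_sum => v _.
    case rv : (reg v).
      under eq_bigr do rewrite andbT.
      apply: ler_wpM2r; [by apply: sumr_ge0|exact: regL].
    rewrite big1 => [|w _]; last by rewrite andbF.
    by rewrite mulr0 mulr_ge0 ?N_ge0 // sumr_ge0.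
  have : 900 * Rg <= (m - 100) * Rg by apply: ler_wpM2r; lra.
  by lra.
have noreg v w : miss a v w -> ~~ reg v.
  apply: contraL => rv; apply: contra h => mvw.
  by apply/existsP; exists v; apply/existsP; exists w; rewrite mvw.
have q_le : q <= 2 * m + 4.
  have := eig_s3 h1; rewrite h2 mulr1 => ->.
  pose W := [set a0; b0; c0].
  have [aW bW cW] : [/\ a0 \in W, b0 \in W & c0 \in W] by rewrite !inE !eqxx ?orbT.
  apply: (@le_trans _ _ (\sum_z (2 + (z \in Ex W)%:R))).
    apply: ler_sum => z _; have [zE|zE] := boolP (z \in Ex W).
      by have := s3_le3 a0 b0 c0 z; rewrite /=; lra.
    rewrite addr0; apply: s3_le2; apply: contra zE => /and3P[t1 t2 t3].
    have [_ az bz] := kneq t1; have [_ _ cz] := kneq t2.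
    by apply: (tetI _ aW bW cW) => //; rewrite !inE !negb_or !(eq_sym z) az bz cz.
  rewrite big_split /= sumr_const card_ord sum_indicator -[_ *+ n]mulr_natr -mE.
  have : #|Ex W|%:R <= 2 :> R by rewrite ler_nat.
  lra.
(* Here [v] spans a face with [a] and every regular z, of value at least (m - 100) / q, which
   exceeds 1/4 by [q_le]; all but at most five z are regular. *)
have big v w : miss a v w -> 200 <= N a v.
  move=> mvw; have nrv := noreg _ _ mvw; have /and4P[_ va' _ _] := mvw.
  have kreg z : reg z -> k a v z.
    move=> rz; apply: contraT => nk; have zv : z != v by apply: contraNneq nrv => <-.
    have za : z != a by move: rz; rewrite /reg !inE !negb_or => /andP[/andP[/andP[]]].
    have mzv : miss a z v by rewrite /miss zv za va' k23.
    by have := noreg _ _ mzv; rewrite rz.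
  have quarter z : 1/4 * (reg z)%:R <= X a v z.
    case rz : (reg z); last by rewrite mulr0 X_ge0.
    have := eig (kreg _ rz); have := regL _ rz; have := N_ge0 a v; have := N_ge0 v z => *.
    rewrite mulr1 leNgt; apply/negP => lt4.
    have : q * X a v z <= q * (1/4) by rewrite ler_wpM2l //; lra.
    lra.
  apply: le_trans (ler_sum _ (fun z _ => quarter z)); rewrite -mulr_sumr.
  have : \sum_(z : 'I_n) (1 : R) <= \sum_z (reg z)%:R + \sum_z (irr z)%:R + #|[set a; b; c]|%:R.
    rewrite -sum_indicator -!big_split; apply: ler_sum => z _ /=; rewrite /reg /irr.
    have [->|za] := eqVneq z a; first by rewrite !inE eqxx /= andbF add0r lerDr.
    case: (z \in [set a; b; c]); case: (k b c z) => /=; lra.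
  have : #|[set a; b; c]|%:R <= 3 :> R.
    by rewrite ler_nat -setUA cardsU1 cards2; case: (a \notin _); case: (_ != _).
  rewrite sumr_const card_ord -mE; lra.
have : 200 * P <= \sum_v N a v * \sum_w (miss a v w)%:R.
  rewrite /P mulr_sumr; apply: ler_sum => v _; rewrite !mulr_sumr; apply: ler_sum => w _.
  case mvw : (miss a v w); last by rewrite !mulr0.
  by rewrite ler_wpM2r // (big _ _ mvw).
lra.
Qed.

End Core.

(** * Homology *)

Section Cycles.
Variables (R : realType) (n : nat).
Let T := {set 'I_n}.
Let V := {ffun T -> R^o}.
Implicit Types (F G W : T) (S : {set T}) (c : V) (u v w : 'I_n).

(** Used for [v] outside [G]: the incidence sign of [G] in [v |: G]. *)
Definition sgn G v : R := (-1) ^+ #|[set w in G | (w < v)%N]|.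

Lemma sgn_sqr G v : sgn G v * sgn G v = 1.
Proof. by rewrite -expr2 sqrr_sign. Qed.

Lemma sgn_neq0 G v : sgn G v != 0.
Proof. by rewrite signr_eq0. Qed.

Lemma sgnU1 G v w : v \notin G -> sgn (v |: G) w = sgn G w * (-1) ^+ (v < w)%N.
Proof.
move=> vG; rewrite /sgn -exprD; congr (_ ^+ _).
rewrite addnC; case vw : (v < w)%N.
  rewrite -(_ : v |: [set x in G | (x < w)%N] = [set x in v |: G | (x < w)%N]).
    by rewrite cardsU1 inE (negPf vG).
  by apply/setP => x; rewrite !inE; have [->|] := eqVneq x v; rewrite ?vw.
rewrite add0n; congr #|pred_of_set _|; apply/setP => x; rewrite !inE.
by have [->|] := eqVneq x v; rewrite ?vw ?andbF.
Qed.

Definition chain_bd c : V := [ffun G : T => \sum_(v | v \notin G) sgn G v * (c (v |: G) : R)].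

Lemma chain_bd_is_linear : linear chain_bd.
Proof.
move=> a c d; apply/ffunP => G; rewrite !ffunE scaler_sumr -big_split /=.
apply: eq_bigr => v _; rewrite !ffunE mulrDr; congr (_ + _); exact: mulrCA.
Qed.
HB.instance Definition _ := GRing.isLinear.Build R V V _ chain_bd chain_bd_is_linear.

Definition restrict (P : pred T) c : V := [ffun F : T => if P F then c F else 0].

Lemma restrict_is_linear P : linear (restrict P).
Proof.
move=> a c d; apply/ffunP => G; rewrite !ffunE; case: (P G) => //.
by rewrite scaler0 addr0.
Qed.
HB.instance Definition _ P := GRing.isLinear.Build R V V _ (restrict P) (restrict_is_linear P).

(** Cutting out 2-cycles supported on [S] inside one fixed chain space on all sets makes different
    families [S] comparable; for [S] made of triples only the boundary on pairs matters. *)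
Definition cycles S : {vspace V} :=
  (lker (linfun (restrict (fun F : T => #|F| == 2%N) \o chain_bd)) :&:
   lker (linfun (restrict (fun F : T => F \notin S))))%VS.

Lemma restrict0P (P : pred T) c :
  reflect (forall F, P F -> c F = 0) (c \in lker (linfun (restrict P))).
Proof.
rewrite memv_ker lfunE /=; apply: (iffP eqP) => [/ffunP h F PF|h].
  by have := h F; rewrite !ffunE PF.
by apply/ffunP => F; rewrite !ffunE; case: ifP => // /h.
Qed.

Lemma cyclesP S c : reflect
  ((forall G, #|G| = 2%N -> \sum_(v | v \notin G) sgn G v * (c (v |: G) : R) = 0) /\
   (forall F, F \notin S -> c F = 0)) (c \in cycles S).
Proof.
rewrite memv_cap; apply: (iffP andP) => -[h1 h2]; split.
- move=> G G2; move: h1; rewrite memv_ker lfunE /= => /eqP /ffunP /(_ G).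
  by rewrite !ffunE /= G2 eqxx.
- by move=> F FS; apply: (restrict0P _ _ h2).
- rewrite memv_ker lfunE /=; apply/eqP/ffunP => G; rewrite !ffunE /=.
  by case: eqP => // /h1.
- by apply/restrict0P.
Qed.

(* Chains z j with private faces g j are linearly independent. *)
Lemma card_private (U : {vspace V}) (J : finType) (A : {set J}) (z : J -> V) (g : J -> T) :
  (forall j, j \in A -> z j \in U) -> (forall j, j \in A -> z j (g j) != 0) ->
  (forall i j, i \in A -> j \in A -> i != j -> z i (g j) = 0) -> (#|A| <= \dim U)%N.
Proof.
move=> zU zg zg0; pose X := [tuple z (enum_val i) | i < #|A|].
have fX : free X.
  apply/freeP => l /ffunP l0 i; have := l0 (g (enum_val i)).
  rewrite sum_ffunE !ffunE (bigD1 i) //= big1 ?addr0 => [|j ji].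
    rewrite ffunE (nth_map i) ?size_enum_ord // nth_ord_enum => /eqP.
    by rewrite mulf_eq0 (negPf (zg _ (enum_valP i))) orbF => /eqP.
  rewrite ffunE (nth_map i) ?size_enum_ord // nth_ord_enum.
  rewrite zg0 ?scaler0 ?enum_valP //; by rewrite (inj_eq enum_val_inj).
rewrite -[leqLHS](size_tuple X); move: fX; rewrite /free => /eqP <-.
apply: dimvS; apply/span_subvP => _ /mapP[i _ ->]; exact/zU/enum_valP.
Qed.

(** Rank-nullity: the image of the restriction lies in the span of the indicators of the members of
    [A]. *)
Lemma dim_restrict (U : {vspace V}) (A : {set T}) :
  (\dim U <= \dim (U :&: lker (linfun (restrict (fun F : T => F \in A))))%VS + #|A|)%N.
Proof.
rewrite -[leqLHS](limg_ker_dim (linfun (restrict (fun F : T => F \in A))) U) leq_add2l.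
pose delta F : V := [ffun G => (G == F)%:R].
apply: (@leq_trans (\dim <<[seq delta F | F <- enum A]>>)%VS).
  apply: dimvS; apply/subvP => _ /memv_imgP[c _ ->].
  rewrite lfunE /= (_ : restrict _ _ = \sum_(F <- enum A) c F *: delta F).
    rewrite big_seq; apply: memv_suml => F FA; apply: memvZ.
    by apply: memv_span; exact: map_f.
  apply/ffunP => G; rewrite sum_ffunE ffunE big_enum /=.
  case: ifPn => GA.
    rewrite (bigD1 G) //= !ffunE eqxx big1 ?addr0 => [|F /andP[_ FG]].
      by rewrite [RHS]mulr1.
    by rewrite !ffunE eq_sym (negPf FG) scaler0.
  rewrite big1 // => F FA; rewrite !ffunE; case: eqP => [GF|_]; last by rewrite scaler0.
  by rewrite GF FA in GA.
by apply: leq_trans (dim_span _) _; rewrite size_map -cardE.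
Qed.

(** The image under [chain_bd] of the indicator of [Q], which need not be a face; the sum has at
    most one term. *)
Definition simplex_bd (Q : T) : V :=
  [ffun F : T => \sum_(w | (w \notin F) && (w |: F == Q)) sgn F w].

Lemma simplex_bdE F v : v \notin F -> simplex_bd (v |: F) F = sgn F v.
Proof.
move=> vF; rewrite ffunE (bigD1 v) ?vF ?eqxx //= big1 ?addr0 // => w /andP[/andP[wF /eqP E] wv].
by have := setU11 w F; rewrite E !inE (negPf wv) (negPf wF).
Qed.

Lemma simplex_bd0 (Q : T) F : ~~ ((F \subset Q) && (#|F|.+1 == #|Q|)) -> simplex_bd Q F = 0.
Proof.
move=> h; rewrite ffunE big1 // => w /andP[wF /eqP E].
by move: h; rewrite -E subsetUr cardsU1 wF eqxx.
Qed.

(** The boundary of a boundary is zero: adding [v] and [w] in the two orders gives opposite signs by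
    [sgnU1], so the double sum equals its own negative. *)
Lemma simplex_bd_bd (Q G : T) :
  \sum_(v | v \notin G) sgn G v * (simplex_bd Q (v |: G) : R) = 0.
Proof.
pose h v w : R := if [&& v \notin G, w \notin G, v != w & w |: (v |: G) == Q]
  then sgn G v * sgn (v |: G) w else 0.
have E : \sum_(v | v \notin G) sgn G v * (simplex_bd Q (v |: G) : R) = \sum_v \sum_w h v w.
  rewrite big_mkcond; apply: eq_bigr => v _; case: (boolP (v \in G)) => vG /=.
    by rewrite big1 // => w _; rewrite /h vG.
  rewrite ffunE mulr_sumr big_mkcond; apply: eq_bigr => w _; rewrite /h vG /=.
  by rewrite !inE negb_or (eq_sym w) -andbA; case: (v != w); case: (w \notin G).
have hs v w : h v w = - h w v.
  rewrite /h; have [vG|vG] /= := boolP (v \in G); first by rewrite andbF oppr0.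
  have [wG|wG] /= := boolP (w \in G); first by rewrite oppr0.
  rewrite (eq_sym w) setUCA; have [->|vw] /= := eqVneq v w; first by rewrite oppr0.
  case: ifP => _; last by rewrite oppr0.
  rewrite !sgnU1 //; case: (ltngtP v w) => [lt|gt|/val_inj eq].
  - by rewrite expr1 expr0; ring.
  - by rewrite expr1 expr0; ring.
  - by rewrite eq eqxx in vw.
have : \sum_v \sum_w h v w = - \sum_v \sum_w h v w.
  rewrite {1}exchange_big -sumrN; apply: eq_bigr => v _.
  by rewrite -sumrN; apply: eq_bigr => w _; rewrite hs.
by rewrite E; lra.
Qed.

Lemma simplex_bd_cycle S (Q : T) :
  (forall F, F \subset Q -> #|F|.+1 = #|Q| -> F \in S) -> simplex_bd Q \in cycles S.
Proof.
move=> h; apply/cyclesP; split=> [G _|F FS]; first exact: simplex_bd_bd.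
by apply: simplex_bd0; apply: contra FS => /andP[FQ /eqP F3]; exact: h.
Qed.

(** The coefficients make the two simplex boundaries cancel on the common face [F], so [F] need not
    belong to the complex. *)
Definition bipyramid F p q : V :=
  sgn F p *: simplex_bd (p |: F) - sgn F q *: simplex_bd (q |: F).

Lemma bipyramidE F p q G :
  bipyramid F p q G =
  sgn F p * (simplex_bd (p |: F) G : R) - sgn F q * (simplex_bd (q |: F) G : R) :> R.
Proof. by rewrite /bipyramid !ffunE. Qed.

Lemma bipyramid_cycle S F p q : p \notin F -> q \notin F ->
  (forall G, G != F -> G \subset p |: F -> #|G| = #|F| -> G \in S) ->
  (forall G, G != F -> G \subset q |: F -> #|G| = #|F| -> G \in S) ->
  bipyramid F p q \in cycles S.
Proof.
move=> pF qF hp hq; apply/cyclesP; split=> [G _|G GS].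
  under eq_bigr do rewrite bipyramidE mulrBr !(mulrCA (sgn G _)).
  by rewrite sumrB -!mulr_sumr !simplex_bd_bd !mulr0 subrr.
rewrite bipyramidE; have [->|GF] := eqVneq G F.
  by rewrite !simplex_bdE // !sgn_sqr subrr.
rewrite !simplex_bd0 ?mulr0 ?subrr //; apply: contra GS => /andP[h1 h2].
  by apply: hq => //; move: h2; rewrite cardsU1 qF add1n eqSS => /eqP.
by apply: hp => //; move: h2; rewrite cardsU1 pF add1n eqSS => /eqP.
Qed.

Lemma sub_set4 (a b c d : 'I_n) F : F \subset [set a; b; c; d] -> #|F|.+1 = #|[set a; b; c; d]| ->
  #|[set a; b; c; d]| = 4%N ->
  [\/ F = [set a; b; c], F = [set a; b; d], F = [set a; c; d] | F = [set b; c; d]].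
Proof.
set Q := [set a; b; c; d] => FQ F3 Q4.
have un : uniq [:: a; b; c; d].
  by apply/card_uniqP; apply: etrans Q4; apply: eq_card => x; rewrite !inE -!orbA.
have /cards1P[w wE] : #|Q :\: F| == 1.
  by rewrite cardsD (setIidPr FQ) -F3 subSnn.
have FE : F = Q :\ w.
  by rewrite -wE setDDr setDv set0U (setIidPr FQ).
have : w \in Q by have := set11 w; rewrite -wE inE => /andP[].
move: un; rewrite /= !inE !negb_or !andbT => /and3P[/and3P[ab ac ad] /andP[bc bd] cd].
rewrite FE /Q -!orbA => /or4P[] /eqP ->; [apply: Or44|apply: Or43|apply: Or42|apply: Or41];
  apply/setP => x; rewrite !inE.
- by have [->|] := eqVneq x a; rewrite ?(negPf ab) ?(negPf ac) ?(negPf ad).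
- by have [->|] := eqVneq x b; rewrite ?orbF ?(eq_sym b a) ?(negPf ab) ?(negPf bc) ?(negPf bd).
- have [->|] := eqVneq x c; rewrite ?orbF ?(eq_sym c a) ?(eq_sym c b) //.
  by rewrite (negPf ac) (negPf bc) (negPf cd).
- by have [->|] := eqVneq x d; rewrite ?orbF ?(eq_sym d) ?(negPf ad) ?(negPf bd) ?(negPf cd).
Qed.

Definition kface (K : {set T}) (a b c : 'I_n) := [set a; b; c] \in tri K.

Lemma kface12 K (a b c : 'I_n) : kface K a b c = kface K b a c.
Proof. by rewrite /kface (setUC [set a]). Qed.

Lemma kface23 K (a b c : 'I_n) : kface K a b c = kface K a c b.
Proof. by rewrite /kface -setUA (setUC [set b]) setUA. Qed.

Lemma kfacexx K (a c : 'I_n) : kface K a a c = false.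
Proof. by rewrite /kface inE setUid cards2; case: (a != c); rewrite andbF. Qed.

Lemma kface_card K (a b c : 'I_n) : kface K a b c -> #|[set a; b; c]| = 3%N.
Proof. by rewrite /kface inE => /andP[_ /eqP]. Qed.

Lemma cycles_at_link (K : {set T}) W z : z \notin W -> link_cycle (kface K) W z ->
  exists p : V * T, [/\ p.1 \in cycles (tri K), p.1 p.2 != 0, z \in p.2 &
    forall F, ~~ (F \subset z |: W) -> p.1 F = 0].
Proof.
move=> zW /orP[/existsP[a /existsP[b /existsP[c]]]|/existsP[a /existsP[b /existsP[p /existsP[r]]]]].
  case/and5P => aW bW cW abc /and3P[abz acz bcz].
  have cz : c != z by apply: contraNneq zW => <-.
  have cab : c \notin [set a; b; z].
    have := kface_card abc; rewrite setUC cardsU1 !inE negb_or negb_or cz andbT.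
    rewrite cards2; by case: (c == a); case: (c == b) => //=; case: (a != b).
  have Q4 : #|[set a; b; z; c]| = 4%N by rewrite setUC cardsU1 cab (kface_card abz).
  exists (simplex_bd [set a; b; z; c], [set a; b; z]); split => /=.
  - apply: simplex_bd_cycle => F FQ F3.
    have [] := sub_set4 FQ F3 Q4 => ->; [exact: abz|exact: abc| |].
      by move: acz; rewrite kface23.
    by move: bcz; rewrite kface23.
  - by rewrite setUC simplex_bdE ?sgn_neq0.
  - by rewrite !inE eqxx ?orbT.
  - move=> F nF; apply: simplex_bd0; apply: contra nF => /andP[FQ _].
    apply: subset_trans FQ _; apply/subsetP => x; rewrite !inE -!orbA.
    by case/or4P => /eqP ->; rewrite ?eqxx ?aW ?bW ?cW ?orbT.
case/and5P => aW bW pW rW /and5P[pr abp abr azp /and3P[bzp azr bzr]].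
have neq x y : x \in W -> y = z -> x != y by move=> xW ->; apply: contraNneq zW => <-.
have [az bz pz rz] : [/\ a != z, b != z, p != z & r != z] by split; exact: neq.
have d3 x y w : kface K x y w -> [/\ x != y, x != w & y != w].
  move=> /kface_card; rewrite -setUA cardsU1 cards2 !inE negb_or.
  by case: (x == y); case: (x == w); case: (y == w).
have [ab ap bp] := d3 _ _ _ abp; have [_ ar br] := d3 _ _ _ abr.
pose F := [set a; b; z].
have F3 : #|F| = 3%N by rewrite /F -setUA cardsU1 cards2 !inE negb_or ab az bz.
have pF : p \notin F by rewrite !inE !negb_or eq_sym ap eq_sym bp pz.
have rF : r \notin F by rewrite !inE !negb_or eq_sym ar eq_sym br rz.
have sub x : x \notin F -> kface K a b x -> kface K a z x -> kface K b z x ->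
    forall G, G != F -> G \subset x |: F -> #|G| = #|F| -> G \in tri K.
  move=> xF abx azx bzx G GF; rewrite setUC => GQ G3.
  have Q4 : #|[set a; b; z; x]| = 4%N by rewrite setUC cardsU1 xF -/F F3.
  have [] := sub_set4 GQ _ Q4; first by rewrite G3 F3 Q4.
  - by move=> E; rewrite E eqxx in GF.
  - by move=> ->.
  - by move=> ->.
  - by move=> ->.
have apz : b \notin [set a; z; p] by rewrite !inE !negb_or eq_sym ab bz bp.
exists (bipyramid F p r, [set a; z; p]); split => /=.
- by apply: bipyramid_cycle => //; apply: sub.
- rewrite bipyramidE (_ : p |: F = b |: [set a; z; p]); last first.
    apply/setP => x; rewrite !inE.
    by case: (x == p); case: (x == b); case: (x == a); case: (x == z).
  rewrite simplex_bdE // (simplex_bd0 (Q := r |: F)).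
    by rewrite mulr0 subr0 mulf_neq0 // sgn_neq0.
  apply/negP => /andP[/subsetP /(_ p)]; rewrite !inE eqxx ?orbT => /(_ isT) + _.
  rewrite (negPf pr) /= => H; by move: pF; rewrite !inE H.
- by rewrite !inE eqxx ?orbT.
- move=> G nG; rewrite bipyramidE !simplex_bd0 ?mulr0 ?subr0 //.
    apply: contra nG => /andP[GQ _]; apply: subset_trans GQ _.
    apply/subsetP => x; rewrite !inE -!orbA.
    by case/or4P => /eqP ->; rewrite ?eqxx ?aW ?bW ?rW ?orbT.
  apply: contra nG => /andP[GQ _]; apply: subset_trans GQ _.
  apply/subsetP => x; rewrite !inE -!orbA.
  by case/or4P => /eqP ->; rewrite ?eqxx ?aW ?bW ?pW ?orbT.
Qed.

(** The cycle at [z] is supported inside [z |: W] and has a face through [z]; that face is not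
    inside [z' |: W] for another [z'] outside [W], so it is private. *)
Lemma card_link_cycles (K : {set T}) W :
  (#|[set z | (z \notin W) && link_cycle (kface K) W z]| <= \dim (cycles (tri K)))%N.
Proof.
set A := [set _ | _].
have /choice[f fP] : forall z, exists p : V * T, z \in A ->
    [/\ p.1 \in cycles (tri K), p.1 p.2 != 0, z \in p.2 &
    forall F, ~~ (F \subset z |: W) -> p.1 F = 0].
  move=> z; have [|zA] := boolP (z \in A); last by exists (0, set0).
  by rewrite inE => /andP[zW /(cycles_at_link zW)[p pP]]; exists p.
apply: (@card_private _ _ A (fun z => (f z).1) (fun z => (f z).2)).
- by move=> z /fP[].
- by move=> z /fP[].
- move=> i j iA jA ij; have [_ _ _ h] := fP i iA; have [_ _ jj _] := fP j jA.
  apply: h; apply/negP => /subsetP /(_ j jj); rewrite !inE eq_sym (negPf ij) /=.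
  by move: jA; rewrite inE => /andP[/negPf ->].
Qed.

Section Apex.
Variables (a : 'I_n) (S : {set T}).
Hypothesis S3 : forall F, F \in S -> #|F| = 3%N.

(* Add the missing faces through a: each face F avoiding a then bounds with the
   cone over it, and each missing face costs at most one dimension. *)
Lemma card_avoiding_le :
  (#|[set F in S | a \notin F]| <=
   \dim (cycles S) + #|[set F : T | [&& #|F| == 3%N, a \in F & F \notin S]]|)%N.
Proof.
set E := [set _ in S | _]; set M := [set F : T | _].
pose S' := S :|: [set F : T | (#|F| == 3%N) && (a \in F)].
apply: (@leq_trans (\dim (cycles S'))).
  apply: (@card_private _ _ E (fun F => simplex_bd (a |: F)) id).
  - move=> F; rewrite inE => /andP[FS aF]; apply: simplex_bd_cycle => G GQ.
    rewrite cardsU1 aF (S3 FS) => -[G3]; rewrite !inE G3 eqxx /=.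
    have [|aG] := boolP (a \in G); first by rewrite orbT.
    rewrite orbF (_ : G = F) //; apply/eqP; rewrite eqEcard G3 S3 // andbT.
    apply/subsetP => x xG; have := subsetP GQ x xG; rewrite !inE => /orP[/eqP xa|//].
    by rewrite -xa xG in aG.
  - by move=> F; rewrite inE => /andP[_ aF]; rewrite simplex_bdE // sgn_neq0.
  - move=> F G; rewrite !inE => /andP[FS aF] /andP[GS aG] FG; apply: simplex_bd0.
    apply: contra FG => /andP[/subsetP GQ _]; rewrite eq_sym eqEcard !S3 // andbT.
    apply/subsetP => x xG; have := GQ x xG; rewrite !inE => /orP[/eqP xa|//].
    by rewrite -xa xG in aG.
apply: leq_trans (dim_restrict _ M) _; rewrite leq_add2r; apply: dimvS.
apply/subvP => c; rewrite memv_cap => /andP[/cyclesP[c1 c2] /restrict0P c3].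
apply/cyclesP; split => // F FS; have [FM|FM] := boolP (F \in M); first exact: c3.
apply: c2; apply: contra FM; rewrite !inE (negPf FS) /= => /andP[-> ->]; by rewrite andbT.
Qed.

(** A cycle vanishing on the faces that avoid [a] is zero: on the edge [F :\ a] its boundary has the
    single term coming from [F]. *)
Lemma dim_cycles_le : (\dim (cycles S) <= #|[set F in S | a \notin F]|)%N.
Proof.
set E := [set _ in S | _].
apply: leq_trans (dim_restrict _ E) _.
suff -> : (cycles S :&: lker (linfun (restrict (fun F : T => F \in E))))%VS = 0%VS by rewrite dimv0.
apply/eqP; rewrite -subv0; apply/subvP => c; rewrite memv_cap memv0.
move=> /andP[/cyclesP[c1 c2] /restrict0P c3]; apply/eqP/ffunP => F; rewrite ffunE.
have noa G : a \notin G -> c G = 0.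
  move=> aG; have [GS|/c2 //] := boolP (G \in S); apply: c3; by rewrite inE GS.
have [aF|/noa //] := boolP (a \in F).
have [FS|/c2 //] := boolP (F \in S).
have aFa : a \notin F :\ a by rewrite !inE eqxx.
have F2 : #|F :\ a| = 2%N by have := cardsD1 a F; rewrite aF (S3 FS) => -[].
have := c1 _ F2; rewrite (bigD1 a) //= big1 ?addr0 => [|v /andP[vF va]]; last first.
  by rewrite noa ?mulr0 // !inE eqxx eq_sym (negPf va).
by rewrite setD1K // => /eqP; rewrite mulf_eq0 (negPf (sgn_neq0 _ _)) => /eqP.
Qed.

End Apex.

End Cycles.

Lemma cochain3_eq0 (R : realType) n (K : {set {set 'I_n}}) (c : cochain R K 3) :
  (forall F, F \in K -> #|F| <= 3)%N -> c = 0.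
Proof.
by move=> h; apply/ffunP => -[F /= FK]; have /andP[/h + /eqP F4] := FK; rewrite F4.
Qed.

(** * The second Betti number as a dimension of cycles *)

Section Betti.
Variables (R : realType) (n : nat) (K : {set {set 'I_n}}).
Hypothesis sK : simplicial_complex K.
Hypothesis K3 : forall F, F \in K -> (#|F| <= 3)%N.

HB.instance Definition _ i :=
  GRing.isLinear.Build _ _ _ _ (@boundary_fun n R K i) (@boundary_fun_is_linear n R K i).

Let extend (c : cochain R K 2) : {ffun {set 'I_n} -> R^o} :=
  [ffun F => oapp c 0 (insub F)].

Let extend_is_linear : linear extend.
Proof.
move=> a c d; apply/ffunP => F; rewrite !ffunE; case: insubP => [u _ _|_] /=.
  by rewrite !ffunE.
by rewrite scaler0 addr0.
Qed.
HB.instance Definition _ := GRing.isLinear.Build R _ _ _ extend extend_is_linear.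

Let extendE (c : cochain R K 2) (F : face K 2) : extend c (val F) = c F.
Proof. by rewrite ffunE valK. Qed.

Let boundary_extend (c : cochain R K 2) (G : face K 1) :
  boundary R K 1 c G = \sum_(v | v \notin val G) sgn R (val G) v * (extend c (v |: val G) : R).
Proof.
rewrite /boundary lfunE /= ffunE.
rewrite (exchange_big_dep xpredT) //=.
rewrite [RHS]big_mkcond; apply: eq_bigr => v _.
case: ifPn => vG.
  have vGD : (v |: val G) :\ v = val G by rewrite setU1K.
  have cardE : #|[set w in v |: val G | (w < v)%N]| = #|[set w in val G | (w < v)%N]|.
    by apply: eq_card => w; rewrite !inE; case: eqVneq => [->|//]; rewrite ltnn !andbF.
  rewrite ffunE; case: insubP => [F FK FE|nK] /=.
    rewrite (bigD1 F) /=; last by rewrite FE setU11 vGD eqxx.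
    rewrite big1 ?addr0; first by rewrite FE cardE.
    move=> H /andP[/andP[vH /eqP HG] /eqP HF]; case: HF; apply: val_inj.
    by rewrite /= FE -HG setD1K.
  rewrite mulr0 big1 // => H /andP[vH /eqP HG].
  case/negP: nK; rewrite -HG setD1K //; exact: (valP H).
by rewrite big1 // => H /andP[vH /eqP HG]; rewrite -HG !inE eqxx in vG.
Qed.

(** There are no 3-faces, so no boundaries are divided out, and extension by zero embeds the kernel
    injectively as the cycles. *)
Lemma betti2E : betti2 R K = \dim (cycles R (tri K)).
Proof.
rewrite /betti2 (_ : \dim (limg (boundary R K 2)) = 0%N) ?subn0; last first.
  apply/eqP; rewrite dimv_eq0 -subv0; apply/subvP => _ /memv_imgP[c _ ->].
  by rewrite (cochain3_eq0 c) // linear0 mem0v.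
have -> : cycles R (tri K) = (linfun extend @: lker (boundary R K 1))%VS.
  apply/vspaceP => c; apply/cyclesP/memv_imgP => [[c1 c2]|[d]].
    pose d : cochain R K 2 := [ffun F => c (val F)].
    have cd : extend d = c.
      apply/ffunP => F; rewrite ffunE; case: insubP => [u _ <-|nF] /=; first by rewrite ffunE.
      by rewrite c2 // inE.
    exists d; last by rewrite lfunE.
    rewrite memv_ker; apply/eqP/ffunP => G; rewrite boundary_extend ffunE cd.
    by apply: c1; have /andP[_ /eqP] := valP G.
  rewrite memv_ker => /eqP /ffunP d0 ->; rewrite [linfun extend d]lfunE /=; split => [G G2|F FK].
    have [GK|GK] := boolP (G \in K).
      have GP : (G \in K) && (#|G| == 2%N) by rewrite GK G2.
      have E := boundary_extend d (Sub G GP : face K 1); move: (d0 (Sub G GP)).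
      by rewrite [RHS]ffunE => d0G; rewrite -[LHS]E.
    (* A pair outside [K] lies in no face of [K], as [K] is closed under subsets. *)
    rewrite big1 // => v vG; rewrite ffunE insubF ?mulr0 //.
    apply/negbTE; apply: contra GK => /andP[vK _]; apply: sK vK _; exact: subsetUr.
  by rewrite ffunE insubF //; apply/negbTE; move: FK; rewrite inE.
rewrite limg_dim_eq //; apply/eqP; rewrite -subv0; apply/subvP => c.
rewrite memv_cap memv0 => /andP[_]; rewrite memv_ker lfunE /= => /eqP /ffunP h.
by apply/eqP/ffunP => F; rewrite -extendE h !ffunE.
Qed.

End Betti.

(** * Complexes with a large eigenvalue are tented *)

Section Triples.
Variables (R : realType) (n : nat).
Implicit Types (F G E : {set 'I_n}) (x y : {set 'I_n} -> R) (a b c v w z : 'I_n).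

Lemma set3_neq a b c : #|[set a; b; c]| = 3%N -> [/\ a != b, a != c & b != c].
Proof.
rewrite -setUA cardsU1 cards2 !inE negb_or.
by case: (a == b); case: (a == c); case: (b == c).
Qed.

Lemma card_set3 a b c : a != b -> a != c -> b != c -> #|[set a; b; c]| = 3%N.
Proof. by move=> ab ac bc; rewrite -setUA cardsU1 cards2 !inE negb_or ab ac bc. Qed.

Lemma set3P F : #|F| = 3%N -> exists a b c, F = [set a; b; c].
Proof.
move=> F3; have /card_gt0P[a aF] : (0 < #|F|)%N by rewrite F3.
have /eqP/cards2P[b [c [_ E]]] : #|F :\ a| = 2%N by have := cardsD1 a F; rewrite aF F3 => -[].
by exists a, b, c; rewrite -setUA -E setD1K.
Qed.

Lemma set3_mem F a : #|F| = 3%N -> a \in F -> exists b c, F = [set a; b; c].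
Proof.
move=> F3 aF.
have /eqP/cards2P[b [c [_ E]]] : #|F :\ a| = 2%N by have := cardsD1 a F; rewrite aF F3 => -[].
by exists b, c; rewrite -setUA -E setD1K.
Qed.

Lemma star_pair x a b : (forall F, #|F| != 3%N -> x F = 0) -> a != b ->
  star x [set a; b] = \sum_z x [set a; b; z].
Proof.
move=> x0 ab; set E := [set a; b].
transitivity (\sum_F \sum_z (if (z \notin E) && (F == z |: E) then x F else 0)).
  rewrite /star big_mkcond; apply: eq_bigr => F _; case: ifPn => EF; last first.
    rewrite big1 // => z _; case: ifP => // /andP[_ /eqP FE].
    by rewrite FE subsetUr in EF.
  have [/eqP F3|F3] := boolP (#|F| == 3%N); last first.
    by rewrite x0 // big1 // => z _; rewrite if_same.
  have /cards1P[z zE] : #|F :\: E| == 1 by rewrite cardsD (setIidPr EF) F3 /E cards2 ab.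
  have zF : z \notin E by have := set11 z; rewrite -zE inE => /andP[].
  have FE : F = z |: E.
    rewrite -zE setUC; apply/setP => y; rewrite !inE; have := subsetP EF y.
    by rewrite !inE; case: ((y == a) || (y == b)) => // ->.
  rewrite (bigD1 z) //= zF -FE eqxx /= big1 ?addr0 // => w wz.
  case: ifP => // /andP[wE /eqP FE']; have : w \in F by rewrite FE' setU11.
  by rewrite FE !inE (negPf wz) /=; move: wE; rewrite !inE => /negPf ->.
rewrite exchange_big; apply: eq_bigr => z _.
have [zE|zE] := boolP (z \in E) => /=.
  rewrite big1 // x0 // setUC (setUidPr _) ?sub1set //.
  by rewrite /E cards2 ab.
by rewrite -big_mkcond big_pred1_eq setUC.
Qed.

Lemma sum_edges (h : {set 'I_n} -> R) a b c : a != b -> a != c -> b != c ->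
  \sum_(E : {set 'I_n} | (#|E| == 2%N) && (E \subset [set a; b; c])) h E =
  h [set a; b] + h [set a; c] + h [set b; c].
Proof.
move=> ab ac bc.
have e1 : [set a; c] != [set a; b].
  apply/negP => /eqP/setP /(_ c).
  by rewrite !inE eqxx orbT (eq_sym c a) (negPf ac) eq_sym (negPf bc).
have e2 : [set b; c] != [set a; b].
  apply/negP => /eqP/setP /(_ c).
  by rewrite !inE eqxx orbT (eq_sym c a) (negPf ac) eq_sym (negPf bc).
have e3 : [set b; c] != [set a; c].
  by apply/negP => /eqP/setP /(_ b); rewrite !inE eqxx (eq_sym b a) (negPf ab) (negPf bc).
have sub v w : v \in [set a; b; c] -> w \in [set a; b; c] -> [set v; w] \subset [set a; b; c].
  by move=> v1 w1; rewrite subUset !sub1set v1 w1.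
rewrite (bigD1 [set a; b]) /=; last by rewrite cards2 ab sub // !inE eqxx ?orbT.
rewrite (bigD1 [set a; c]) /=; last by rewrite cards2 ac sub // !inE eqxx ?orbT.
rewrite (bigD1 [set b; c]) /=; last by rewrite cards2 bc sub ?e2 // !inE eqxx ?orbT.
rewrite big1 ?addr0 ?addrA // => E /andP[/andP[/andP[/andP[E2 EF] n1] n2] n3].
have /cards1P[w wE] : #|[set a; b; c] :\: E| == 1.
  by rewrite cardsD (setIidPr EF) card_set3 // (eqP E2).
have FE : E = [set a; b; c] :\ w by rewrite -wE setDDr setDv set0U (setIidPr EF).
have : w \in [set a; b; c] by have := set11 w; rewrite -wE inE => /andP[].
rewrite !inE -!orbA => /or3P[] /eqP wv; rewrite {}wv in FE.
- case/eqP: n3; rewrite FE; apply/setP => v; rewrite !inE.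
  by have [->|] := eqVneq v a; rewrite ?(negPf ab) ?(negPf ac).
- case/eqP: n2; rewrite FE; apply/setP => v; rewrite !inE.
  by have [->|] := eqVneq v b; rewrite ?orbF ?(eq_sym b a) ?(negPf ab) ?(negPf bc).
- case/eqP: n1; rewrite FE; apply/setP => v; rewrite !inE.
  by have [->|] := eqVneq v c; rewrite ?orbF ?(eq_sym c) ?(negPf ac) ?(negPf bc).
Qed.

(** [card_avoiding_le] in terms of ordered tuples: at most 3^3 triples lie in a given face, and
    every missing face comes from some pair. *)
Lemma card_ext_faces (K : {set {set 'I_n}}) a : \dim (cycles R (tri K)) = 2%N ->
  \sum_v \sum_w \sum_z [&& v != a, w != a, z != a & kface K v w z]%:R <=
  27 * (\sum_v \sum_w [&& v != w, v != a, w != a & ~~ kface K a v w]%:R + 2) :> R.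
Proof.
move=> d2; have tri3 F : F \in tri K -> #|F| = 3%N by rewrite inE => /andP[_ /eqP].
have := card_avoiding_le R a tri3; rewrite d2.
set E := [set F in tri K | _]; set M := [set F : {set 'I_n} | _] => EM.
have E27 : \sum_v \sum_w \sum_z [&& v != a, w != a, z != a & kface K v w z]%:R <=
    27 * #|E|%:R :> R.
  apply: (@le_trans _ _ (\sum_v \sum_w \sum_z \sum_(F in E)
      ((v \in F)%:R * ((w \in F)%:R * (z \in F)%:R)))).
    apply: ler_sum => v _; apply: ler_sum => w _; apply: ler_sum => z _.
    case: (boolP [&& _, _, _ & _]) => [/and4P[va wa za vwz]|_]; last first.
      by apply: sumr_ge0 => F _; rewrite !mulr_ge0 ?ler0n.
    rewrite (bigD1 [set v; w; z]) /=; last first.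
      rewrite inE; apply/andP; split; first exact: vwz.
      by rewrite !inE !negb_or !(eq_sym a) va wa za.
    rewrite !inE !eqxx !orbT !mulr1 lerDl.
    by apply: sumr_ge0 => F _; rewrite !mulr_ge0 ?ler0n.
  rewrite le_eqVlt; apply/orP; left; apply/eqP.
  transitivity (\sum_(F in E) \sum_v \sum_w \sum_z
      ((v \in F)%:R * ((w \in F)%:R * (z \in F)%:R)) : R).
    rewrite [RHS]exchange_big; apply: eq_bigr => v _ /=.
    rewrite [RHS]exchange_big; apply: eq_bigr => w _ /=.
    by rewrite exchange_big.
  rewrite (eq_bigr (fun=> 27)); first by rewrite sumr_const -[LHS]mulr_natr.
  move=> F; rewrite inE => /andP[/tri3 F3 _].
  under eq_bigr do under eq_bigr do rewrite -!mulr_sumr sum_indicator F3.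
  under eq_bigr do rewrite -mulr_sumr -mulr_suml sum_indicator F3.
  by rewrite -mulr_suml sum_indicator F3; ring.
have M1 : #|M|%:R <= \sum_v \sum_w [&& v != w, v != a, w != a & ~~ kface K a v w]%:R :> R.
  rewrite pair_big /=.
  pose P := [set p : 'I_n * 'I_n | [&& p.1 != p.2, p.1 != a, p.2 != a & ~~ kface K a p.1 p.2]].
  apply: (@le_trans _ _ #|P|%:R); last first.
    rewrite -sum_indicator; apply: ler_sum => p _; by rewrite inE.
  rewrite ler_nat; apply: leq_trans (leq_imset_card (fun p => [set a; p.1; p.2]) P).
  apply: subset_leq_card; apply/subsetP => F; rewrite inE => /and3P[/eqP F3 aF nF].
  have [v [w FE]] := set3_mem F3 aF; apply/imsetP; exists (v, w) => //=.
  rewrite FE in F3 nF; have [av aw vw] := set3_neq F3.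
  by rewrite inE /= vw (eq_sym v) av (eq_sym w) aw.
apply: le_trans E27 _; rewrite ler_wpM2l // addrC.
apply: (@le_trans _ _ (2 + #|M|%:R)); last by rewrite lerD2l.
by rewrite -natrD ler_nat.
Qed.

Lemma K22_cycles (K : {set {set 'I_n}}) : K22 R K ->
  (forall F, F \in K -> exists2 G : {set 'I_n}, F \subset G & G \in tri K) /\
  \dim (cycles R (tri K)) = 2%N.
Proof.
case=> sK _ pK bK.
have cov F : F \in K -> exists2 G : {set 'I_n}, F \subset G & G \in tri K.
  move=> FK; have [G Gmax FG] := maxset_exists FK.
  by exists G => //; rewrite inE (pK _ Gmax) eqxx andbT; have /maxsetP[] := Gmax.
split=> //; rewrite -betti2E // => F /cov[G FG]; rewrite inE => /andP[_ /eqP G3].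
by apply: leq_trans (subset_leq_card FG) _; rewrite G3.
Qed.

Lemma face_edge (K : {set {set 'I_n}}) F : simplicial_complex K -> F \in tri K ->
  exists e : face K 1, True.
Proof.
move=> sK; rewrite inE => /andP[FK /eqP F3]; have [a [b [c FE]]] := set3P F3.
rewrite FE in F3 FK; have [ab _ _] := set3_neq F3.
have abK : ([set a; b] \in K) && (#|[set a; b]| == 2%N).
  by rewrite cards2 ab (sK _ _ FK) // subsetUl.
by exists (Sub [set a; b] abK).
Qed.

Lemma K22_edge (K : {set {set 'I_n}}) : (0 < n)%N -> K22 R K -> exists e : face K 1, True.
Proof.
move=> n0 HK; have [cov _] := K22_cycles HK; have [sK vK _ _] := HK.
by have [G _] := cov _ (vK (Ordinal n0)); exact: face_edge.
Qed.

Lemma star_set3 x a b c : (forall F, #|F| != 3%N -> x F = 0) -> #|[set a; b; c]| = 3%N ->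
  \sum_(E : {set 'I_n} | (#|E| == 2%N) && (E \subset [set a; b; c])) star x E =
  \sum_z x [set a; b; z] + \sum_z x [set a; c; z] + \sum_z x [set b; c; z].
Proof.
move=> x0 /set3_neq[ab ac bc].
by rewrite sum_edges // !star_pair.
Qed.

Theorem apex_of_large (K : {set {set 'I_n}}) : (1000 <= n)%N -> K22 R K ->
  2 * n%:R - 3 < q1 R K -> exists a, forall F, #|F| = 3%N -> a \in F -> F \in tri K.
Proof.
move=> n1000 HK qn; have [cov d2] := K22_cycles HK.
have n1000' : 1000 <= n%:R :> R by rewrite ler_nat.
have [e _] := K22_edge (leq_trans (isT : (0 < 1000)%N) n1000) HK; have [sK _ _ _] := HK.
have q0 : 0 < q1 R K by lra.
have [x [x_ge0 x0 [F1 xF1] xq]] := q1_perron sK e q0.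
have x03 F : #|F| != 3%N -> x F = 0 by move=> F3; apply: x0; rewrite inE (negPf F3) andbF.
pose F0 := [arg max_(F > F1) x F]%O.
have F0max F : x F <= x F0.
  by rewrite /F0; case: Order.TotalTheory.arg_maxP => // G _ h; exact: h.
have x1 : 0 < x F0 by exact: lt_le_trans (F0max F1).
have F0K : F0 \in tri K by apply: contraTT x1 => /x0 ->; rewrite ltxx.
have [a0 [b0 [c0 F0E]]] : exists a b c, F0 = [set a; b; c].
  by apply: set3P; move: F0K; rewrite inE => /andP[_ /eqP].
pose X a b c := x [set a; b; c] / x F0.
have [|||||||||||a aP] := @exists_apex R n (kface K) X (q1 R K)
  _ _ _ _ _ _ _ _ n%:R (erefl _) qn n1000' _ _ _.
- exact: kface12.
- exact: kface23.
- exact: kfacexx.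
- by move=> a b c; rewrite /X (setUC [set a]).
- by move=> a b c; rewrite /X -setUA (setUC [set b]) setUA.
- by move=> a b c; rewrite divr_ge0.
- move=> a b c; rewrite /X /kface; case: (boolP (_ \in _)) => abc.
    by rewrite ler_pdivrMr // mul1r.
  by rewrite x0 // mul0r.
- move=> a b c abc; rewrite /X mulrA xq // star_set3 ?(kface_card abc) //.
  by rewrite !mulrDl !mulr_suml.
- by move=> W; apply: leq_trans (card_link_cycles R K W) _; rewrite d2.
- by move=> a; exact: card_ext_faces.
- exists a0, b0, c0; rewrite /X /kface -F0E F0K divff ?eqxx //.
  by rewrite gt_eqF.
exists a => F F3 aF; have [v [w FE]] := set3_mem F3 aF.
rewrite FE in F3 *; have [av aw vw] := set3_neq F3.
by apply: aP; rewrite // eq_sym.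
Qed.

End Triples.

Section Tented.
Variables (R : realType) (n : nat).
Implicit Types (F G E : {set 'I_n}) (x y u : {set 'I_n} -> R) (a b c v w z : 'I_n).

Lemma tentedP a G : reflect (exists F, [/\ #|F| = 3%N, a \in F & G \subset F]) (G \in tented a).
Proof.
rewrite inE; apply: (iffP existsP) => -[F].
  by case/and3P => /eqP F3 aF GF; exists F.
by case=> F3 aF GF; exists F; rewrite F3 eqxx aF GF.
Qed.

(** Replacing a vertex of [F] outside [G] by [a] gives a triple through [a] that contains [G]. *)
Lemma proper_tented a F G : #|F| = 3%N -> a \notin F -> G \proper F -> G \in tented a.
Proof.
move=> F3 aF /properP[GF [y yF yG]]; apply/tentedP; exists (a |: (F :\ y)).
have F2 : #|F :\ y| = 2%N by have := cardsD1 y F; rewrite yF F3 => -[].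
have aFy : a \notin F :\ y by rewrite inE negb_and aF orbT.
split; rewrite ?setU11 ?cardsU1 ?aFy ?F2 //.
apply/subsetP => z zG; rewrite !inE (subsetP GF) // andbT orbC.
by rewrite (contraNneq _ yG) // => <-.
Qed.

(** With no face missing at [a], [card_avoiding_le] and [dim_cycles_le] pin the number of faces
    avoiding [a] to the Betti number; purity then determines all smaller faces. *)
Lemma K22_shape (K : {set {set 'I_n}}) a : K22 R K ->
  (forall F, #|F| = 3%N -> a \in F -> F \in tri K) ->
  exists F1 F2, [/\ F1 != F2, #|F1| = 3%N /\ #|F2| = 3%N, a \notin F1 /\ a \notin F2 &
     K = tented a :|: [set F1; F2]].
Proof.
move=> HK full; have [cov d2] := K22_cycles HK; have [sK _ _ _] := HK.
have tri3 F : F \in tri K -> #|F| = 3%N by rewrite inE => /andP[_ /eqP].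
pose X := [set F in tri K | a \notin F].
have X2 : #|X| = 2%N.
  apply/eqP; rewrite eqn_leq -[X in (_ <= X)%N && _]d2 -[X in _ && (X <= _)%N]d2.
  rewrite (dim_cycles_le R a tri3) andbT.
  have := card_avoiding_le R a tri3.
  rewrite (_ : [set F : {set 'I_n} | _] = set0) ?cards0 ?addn0 //.
  by apply/setP => F; rewrite [LHS]inE [RHS]inE; apply/negP => /and3P[/eqP F3 aF]; rewrite full.
have /eqP/cards2P[F1 [F2 [F12 XE]]] := X2.
have [F1X F2X] : F1 \in X /\ F2 \in X by rewrite XE !inE !eqxx orbT.
have [F1t aF1] : F1 \in tri K /\ a \notin F1 by move: F1X; rewrite inE => /andP.
have [F2t aF2] : F2 \in tri K /\ a \notin F2 by move: F2X; rewrite inE => /andP.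
exists F1, F2; split; [by []|by split; apply: tri3|by []|].
apply/setP => F; rewrite in_setU; apply/idP/orP => [FK|[/tentedP[G [G3 aG FG]]|]].
- have [G FG Gt] := cov _ FK; have [aG|aG] := boolP (a \in G).
    by left; apply/tentedP; exists G; split => //; apply: tri3.
  have GX : G \in X by rewrite inE Gt.
  have [FG'|FG'] := boolP (G \subset F).
    by right; rewrite (_ : F = G) -?XE //; apply/eqP; rewrite eqEsubset FG.
  by left; apply: (proper_tented (F := G)); rewrite ?tri3 // properE FG.
- by apply: sK FG; have := full _ G3 aG; rewrite inE => /andP[].
- by rewrite -XE inE => /andP[]; rewrite inE => /andP[].
Qed.

Section TwoExtraFaces.
Variables (a : 'I_n) (F1 F2 : {set 'I_n}).
Hypotheses (F13 : #|F1| = 3%N) (F23 : #|F2| = 3%N) (aF1 : a \notin F1) (aF2 : a \notin F2)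
  (F12 : F1 != F2).
Let L := tented a :|: [set F1; F2].

Lemma tri_tented F : (F \in tri L) = (#|F| == 3%N) && ((a \in F) || (F \in [set F1; F2])).
Proof.
rewrite inE in_setU andbC; case: (boolP (#|F| == 3%N)) => //= /eqP F3.
case: (F \in [set F1; F2]); rewrite ?orbT // !orbF.
apply/tentedP/idP => [[G [G3 aG FG]]|aF]; last by exists F.
by rewrite (_ : F = G) //; apply/eqP; rewrite eqEcard FG G3 F3.
Qed.

Lemma simplicial_tented : simplicial_complex L.
Proof.
move=> F G; rewrite in_setU => /orP[/tentedP[H [H3 aH FH]]|FX] GF.
  by rewrite in_setU; apply/orP; left; apply/tentedP; exists H; split => //; apply: subset_trans FH.
have [FG|FG] := boolP (F \subset G).
  have -> : G = F by apply/eqP; rewrite eqEsubset GF.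
  by rewrite in_setU FX orbT.
rewrite in_setU; apply/orP; left; apply: (@proper_tented a F); last by rewrite properE GF.
  by move: FX; rewrite !inE => /orP[] /eqP ->.
by move: FX; rewrite !inE => /orP[] /eqP ->.
Qed.

Lemma tented_K22 : K22 R L.
Proof.
have tri3 F : F \in tri L -> #|F| = 3%N by rewrite inE => /andP[_ /eqP].
have L3 F : F \in L -> (#|F| <= 3)%N.
  rewrite in_setU => /orP[/tentedP[G [G3 _ /subset_leq_card]]|]; first by rewrite G3.
  by rewrite !inE => /orP[] /eqP ->; rewrite ?F13 ?F23.
have [b [c [d F1E]]] := set3P F13.
have [bF cF] : b \in F1 /\ c \in F1 by rewrite F1E !inE !eqxx ?orbT.
have [bc _ _] : [/\ b != c, b != d & c != d] by apply: set3_neq; rewrite -F1E.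
have ab : a != b by apply: contraNneq aF1 => ->.
have ac : a != c by apply: contraNneq aF1 => ->.
split.
- exact: simplicial_tented.
- move=> v; rewrite in_setU; apply/orP; left; apply/tentedP.
  have [->|vb] := eqVneq v b.
    by exists [set a; b; c]; rewrite card_set3 // sub1set !inE !eqxx ?orbT.
  have [->|va] := eqVneq v a.
    by exists [set a; b; c]; rewrite card_set3 // sub1set !inE !eqxx ?orbT.
  have av : a != v by rewrite eq_sym.
  by exists [set a; v; b]; rewrite card_set3 // sub1set !inE !eqxx ?orbT.
- move=> F Fmax; have := maxsetp Fmax; rewrite /= in_setU => /orP[/tentedP[G [G3 aG FG]]|].
    have GL : G \in L by rewrite in_setU; apply/orP; left; apply/tentedP; exists G.
    by rewrite -(maxsetsup Fmax GL FG).
  by rewrite !inE => /orP[] /eqP ->.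
rewrite (betti2E R simplicial_tented L3); apply/eqP.
have EX : [set F in tri L | a \notin F] = [set F1; F2].
  apply/setP => F; rewrite inE tri_tented !inE.
  have [->|FF1] := eqVneq F F1; first by rewrite F13 aF1 eqxx !orbT.
  have [->|FF2] := eqVneq F F2; first by rewrite F23 aF2 eqxx !orbT.
  by case: (a \in F); rewrite /= ?andbF.
rewrite eqn_leq; apply/andP; split.
  by apply: leq_trans (dim_cycles_le R a tri3) _; rewrite EX cards2 F12.
have := card_avoiding_le R a tri3; rewrite EX cards2 F12.
rewrite (_ : [set F : {set 'I_n} | _] = set0) ?cards0 ?addn0 //.
apply/setP => F; rewrite [LHS]inE [RHS]inE; apply/negP => /and3P[F3 aF].
by rewrite tri_tented F3 aF.
Qed.

End TwoExtraFaces.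

Lemma star_add u (r s : R) F1 F2 E :
  star (fun F => u F + r * (F == F1)%:R + s * (F == F2)%:R) E =
  star u E + r * (E \subset F1)%:R + s * (E \subset F2)%:R.
Proof.
have one (t : R) G : \sum_(F : {set 'I_n} | E \subset F) t * (F == G)%:R = t * (E \subset G)%:R.
  rewrite -mulr_sumr; congr (_ * _); case: (boolP (E \subset G)) => EG.
    by rewrite (bigD1 G) //= eqxx big1 ?addr0 // => F /andP[_ /negPf ->].
  by rewrite big1 // => F EF; case: eqP => // FG; rewrite FG (negPf EG) in EF.
by rewrite /star 2!big_split /= !one.
Qed.

Lemma star_mul x (g : {set 'I_n} -> R) :
  \sum_(E : {set 'I_n} | #|E| == 2%N) star x E * g E =
  \sum_F x F * \sum_(E : {set 'I_n} | (#|E| == 2%N) && (E \subset F)) g E.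
Proof.
rewrite /star; under eq_bigr do rewrite mulr_suml.
rewrite (exchange_big_dep xpredT) //=; apply: eq_bigr => F _.
by rewrite mulr_sumr; apply: eq_bigl => E; rewrite andbC.
Qed.

(** The operator on weights whose matrix has the entries [common F G]. *)
Definition edge_sum u F : R := \sum_(E : {set 'I_n} | (#|E| == 2%N) && (E \subset F)) star u E.
Definition common F G : R :=
  \sum_(E : {set 'I_n} | (#|E| == 2%N) && (E \subset F)) (E \subset G)%:R.

Lemma common_self F : #|F| = 3%N -> common F F = 3.
Proof.
move=> F3; have [b [c [d FE]]] := set3P F3; rewrite /common FE in F3 *.
have [bc bd cd] := set3_neq F3; rewrite sum_edges //.
by rewrite !subUset !sub1set !inE !eqxx ?orbT /=; ring.
Qed.

Lemma sum_sqr_star u (r s : R) F1 F2 : #|F1| = 3%N -> #|F2| = 3%N ->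
  \sum_(E : {set 'I_n} | #|E| == 2%N)
    star (fun F => u F + r * (F == F1)%:R + s * (F == F2)%:R) E ^+ 2 =
  \sum_(E : {set 'I_n} | #|E| == 2%N) star u E ^+ 2 + 2 * r * edge_sum u F1 + 2 * s * edge_sum u F2
   + 3 * r ^+ 2 + 3 * s ^+ 2 + 2 * r * s * common F1 F2.
Proof.
move=> F13 F23.
have cut (g : {set 'I_n} -> R) F : \sum_(E : {set 'I_n} | #|E| == 2%N) (E \subset F)%:R * g E =
    \sum_(E : {set 'I_n} | (#|E| == 2%N) && (E \subset F)) g E.
  by rewrite big_mkcondr; apply: eq_bigr => E _; case: (E \subset F); rewrite ?mul1r ?mul0r.
have nn F E : (E \subset F)%:R * (E \subset F)%:R = (E \subset F)%:R :> R.
  by case: (E \subset F); rewrite ?mulr1 ?mulr0.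
transitivity (\sum_(E : {set 'I_n} | #|E| == 2%N) (star u E ^+ 2
   + 2 * r * ((E \subset F1)%:R * star u E) + 2 * s * ((E \subset F2)%:R * star u E)
   + r ^+ 2 * ((E \subset F1)%:R * (E \subset F1)%:R)
   + s ^+ 2 * ((E \subset F2)%:R * (E \subset F2)%:R)
   + 2 * r * s * ((E \subset F1)%:R * (E \subset F2)%:R))).
  apply: eq_bigr => E _; rewrite star_add; ring.
rewrite !big_split /= -!mulr_sumr !cut -/(common F1 F1) -/(common F2 F2) -/(common F1 F2).
by rewrite !common_self // -/(edge_sum u F1) -/(edge_sum u F2); ring.
Qed.

Lemma sum_sqr_add u (r s : R) F1 F2 : F1 != F2 -> u F1 = 0 -> u F2 = 0 ->
  \sum_F (u F + r * (F == F1)%:R + s * (F == F2)%:R) ^+ 2 = \sum_F u F ^+ 2 + r ^+ 2 + s ^+ 2.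
Proof.
move=> F12 u1 u2.
have one (t : R) G : \sum_(F : {set 'I_n}) t * (F == G)%:R = t.
  by rewrite (bigD1 G) //= eqxx big1 ?addr0 ?mulr1 // => F /negPf ->; rewrite mulr0.
rewrite -[in RHS](one (r ^+ 2) F1) -[in RHS](one (s ^+ 2) F2) -!big_split /=.
apply: eq_bigr => F _; have [->|n1] := eqVneq F F1.
  by rewrite u1 (negPf F12) /=; ring.
by have [->|n2] := eqVneq F F2; rewrite ?u2 /=; ring.
Qed.

Lemma edge_sum_cone a u b c d : (forall F, a \notin F -> u F = 0) ->
  (forall F, #|F| != 3%N -> u F = 0) -> a \notin [set b; c; d] -> #|[set b; c; d]| = 3%N ->
  edge_sum u [set b; c; d] = u [set a; b; c] + u [set a; b; d] + u [set a; c; d].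
Proof.
move=> ua u3 aF F3; rewrite /edge_sum star_set3 //.
have aE v w : v \in [set b; c; d] -> w \in [set b; c; d] ->
    \sum_z u [set v; w; z] = u [set a; v; w].
  move=> vF wF; rewrite (bigD1 a) //= big1 ?addr0 => [|z za].
    by rewrite setUC setUA.
  apply: ua; rewrite !inE !negb_or (eq_sym a z) za andbT.
  by apply/andP; split; apply: contraNneq aF => ->.
by rewrite !aE // !inE !eqxx ?orbT.
Qed.

End Tented.

(** * Comparing the positions of the two extra faces *)

Section Final.
Variables (R : realType) (n : nat).
Implicit Types (F G E : {set 'I_n}) (x y u : {set 'I_n} -> R) (a b c v w z : 'I_n).

(** The test vector is 1 on faces through [a], t at [F1] and 0 at [F2]. At t = 0 the quotient is
    exactly 2m - 3; in t the form gains 6t + 3t^2 while (2m - 3)t^2 is needed, which at t = 1/m is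
    below 2t. *)
Lemma tented_q1_lower a F1 F2 : (6 <= n)%N -> #|F1| = 3%N -> #|F2| = 3%N ->
  a \notin F1 -> a \notin F2 -> F1 != F2 ->
  2 * n%:R - 3 < q1 R (tented a :|: [set F1; F2]).
Proof.
move=> n6 F13 F23 aF1 aF2 F12; set L := _ :|: _.
have sL : simplicial_complex L := simplicial_tented F13 F23 aF1 aF2.
have triL F : (F \in tri L) = (#|F| == 3%N) && ((a \in F) || (F \in [set F1; F2])).
  exact: tri_tented.
have F1L : F1 \in tri L by rewrite triL F13 eqxx !inE eqxx orbT.
have [e _] := face_edge sL F1L.
have m6 : 6 <= n%:R :> R by rewrite ler_nat.
set m : R := n%:R in m6 *.
pose y F : R := ((#|F| == 3%N) && (a \in F))%:R.
pose t : R := m^-1.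
have mt : m * t = 1 by rewrite divff // gt_eqF //; lra.
have t0 : 0 < t by rewrite invr_gt0; lra.
pose x F : R := y F + t * (F == F1)%:R + 0 * (F == F2)%:R.
have xL F : F \notin tri L -> x F = 0.
  rewrite triL !inE /x /y.
  have [->|n1] := eqVneq F F1; first by rewrite F13 eqxx !orbT.
  have [->|n2] := eqVneq F F2; first by rewrite F23 eqxx !orbT.
  by rewrite /= orbF => /negPf ->; rewrite !mulr0 !addr0.
have := q1_rayleigh sL e xL.
have yF1 : y F1 = 0 by rewrite /y (negPf aF1) andbF.
have yF2 : y F2 = 0 by rewrite /y (negPf aF2) andbF.
have y3 F : #|F| != 3%N -> y F = 0 by rewrite /y => /negPf ->.
have ya F : a \notin F -> y F = 0 by rewrite /y => /negPf ->; rewrite andbF.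
have yE b c : y [set a; b; c] = (#|[set a; b; c]| == 3%N)%:R.
  by rewrite /y !inE eqxx andbT.
have y1 b c : a != b -> a != c -> b != c -> y [set a; b; c] = 1.
  by move=> ab ac bc; rewrite yE card_set3.
rewrite sum_sqr_star // sum_sqr_add //.
have -> : edge_sum y F1 = 3.
  have [b [c [d FE]]] := set3P F13; rewrite FE in F13 aF1 *.
  have [bc bd cd] := set3_neq F13.
  have /and3P[ab ac ad] : [&& a != b, a != c & a != d].
    by move: aF1; rewrite !inE !negb_or -andbA.
  by rewrite (edge_sum_cone ya y3) // !y1 //; ring.
have -> : \sum_F y F ^+ 2 = \sum_F y F.
  by apply: eq_bigr => F _; rewrite /y; case: (_ && _); rewrite ?expr1n ?expr0n.
have -> : \sum_(E : {set 'I_n} | #|E| == 2%N) star y E ^+ 2 = (2 * m - 3) * \sum_F y F.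
  under eq_bigr do rewrite expr2; rewrite star_mul mulr_sumr; apply: eq_bigr => F _.
  case: (boolP ((#|F| == 3%N) && (a \in F))) => h; last by rewrite /y (negPf h) mulr0 mul0r.
  have /andP[/eqP F3 aF] := h; have [v [w FE]] := set3_mem F3 aF.
  rewrite FE in F3 *; have [av aw vw] := set3_neq F3.
  have sv b : a != b -> \sum_z y [set a; b; z] = m - 2.
    move=> ab; have one (p : 'I_n) : \sum_z (z == p)%:R = 1 :> R.
      by rewrite (bigD1 p) //= eqxx big1 ?addr0 // => z /negPf ->.
    have -> : m - 2 = \sum_(z : 'I_n) (1 - (z == a)%:R - (z == b)%:R : R).
      by rewrite !sumrB !one sumr_const card_ord /m; ring.
    apply: eq_bigr => z _; have [->|za] := eqVneq z a.
      by rewrite (negPf ab) /= y3 ?subr0 ?subrr // setUC setUA setUid cards2 ab.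
    have [->|zb] := eqVneq z b.
      by rewrite y3 /= ?subr0 ?subrr // -setUA setUid cards2 ab.
    by rewrite y1 ?subr0 // eq_sym.
  have svw : \sum_z y [set v; w; z] = 1.
    rewrite (bigD1 a) //= big1 ?addr0 => [|z za].
      by rewrite setUC setUA y1.
    by apply: ya; rewrite !inE !negb_or av aw eq_sym.
  by rewrite star_set3 // !sv // svw y1 //; ring.
move=> h; rewrite ltNge; apply/negP => qle.
have Y0 : 0 <= \sum_F y F by apply: sumr_ge0 => F _; rewrite ler0n.
have : q1 R L * (\sum_F y F + t ^+ 2 + 0 ^+ 2) <= (2 * m - 3) * (\sum_F y F + t ^+ 2 + 0 ^+ 2).
  by apply: ler_wpM2r => //; rewrite expr0n addr0 addr_ge0 // sqr_ge0.
move=> /(le_trans h).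
rewrite (_ : (2 * m - 3) * (\sum_F y F + t ^+ 2 + 0 ^+ 2) =
  (2 * m - 3) * (\sum_F y F) + 2 * (m * t) * t - 3 * t ^+ 2); last by ring.
rewrite mt.
rewrite (_ : _ + 2 * t * 3 + _ + _ + _ + _ =
  (2 * m - 3) * (\sum_F y F) + 6 * t + 3 * t ^+ 2); last by ring.
have : 0 <= t ^+ 2 by exact: sqr_ge0.
lra.
Qed.

Lemma common_eq0 F G : (#|F :&: G| <= 1)%N -> common R F G = 0.
Proof.
move=> FG; rewrite /common big1 // => E /andP[/eqP E2 EF].
case: (boolP (E \subset G)) => // EG.
have := subset_leq_card (_ : E \subset F :&: G); rewrite subsetI EF EG E2 => /(_ isT) h.
by have := leq_trans h FG.
Qed.

(** Here 6/1000 is rounded up to 1/100; the 6 fits the bound 3(r + s) in [spoke_eq] as well as three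
    differences of 2(r + s) each. *)
Lemma descale (A d B : R) : 1000 <= A -> 0 <= B -> A * d <= 6 * B -> d <= B / 100.
Proof.
move=> A1 B0 h; rewrite leNgt; apply/negP => dB.
have d0 : 0 < d by apply: le_lt_trans dB; rewrite divr_ge0.
have : 1000 * d <= A * d by rewrite ler_wpM2r // ltW.
lra.
Qed.

Lemma descale3 (A B p1 p2 p3 p1' p2' p3' : R) : 1000 <= A -> 0 <= B ->
  A * (p1 - p1') <= 2 * B -> A * (p2 - p2') <= 2 * B -> A * (p3 - p3') <= 2 * B ->
  p1 + p2 + p3 - (p1' + p2' + p3') <= B / 100.
Proof.
move=> A1 B0 h1 h2 h3; apply: (descale A1 B0).
by rewrite !mulrBr !mulrDr; move: h1 h2 h3; rewrite !mulrBr; lra.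
Qed.

Lemma descale_eq (A B r s t1 t2 : R) : 1000 <= A -> 0 <= B ->
  A * r = t1 -> A * s = t2 -> t2 - t1 <= B / 100 -> s - r <= B / 100.
Proof. by move=> A1 B0 <- <- h; apply: (descale A1 B0); rewrite mulrBr; lra. Qed.

Section Spread.
Variables (a : 'I_n) (F1 F2 : {set 'I_n}) (x : {set 'I_n} -> R) (q : R).
Hypotheses (F13 : #|F1| = 3%N) (F23 : #|F2| = 3%N) (aF1 : a \notin F1) (aF2 : a \notin F2)
  (F12 : (#|F1 :&: F2| <= 1)%N).
Let L := tented a :|: [set F1; F2].
Hypotheses (x_ge0 : forall F, 0 <= x F) (x0 : forall F, F \notin tri L -> x F = 0)
  (xq : forall F, F \in tri L -> q * x F = edge_sum x F).
Hypotheses (n_big : (1002 <= n)%N) (qn : 2 * n%:R - 3 < q).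
Let r := x F1.
Let s := x F2.
Let u F := if a \in F then x F else 0.
Let U v w := x [set a; v; w].
Let S v := \sum_z U v z.

Let F12n : F1 != F2.
Proof. by apply: contraTneq F12 => ->; rewrite setIid F23. Qed.

Let x3 F : #|F| != 3%N -> x F = 0.
Proof. by move=> F3; apply: x0; rewrite inE (negPf F3) andbF. Qed.

Let u3 F : #|F| != 3%N -> u F = 0.
Proof. by move=> /x3; rewrite /u => ->; case: ifP. Qed.

Let ua F : a \notin F -> u F = 0.
Proof. by rewrite /u => /negPf ->. Qed.

Lemma split_apex F : x F = u F + r * (F == F1)%:R + s * (F == F2)%:R.
Proof.
rewrite /u /r /s; have [aF|aF] := boolP (a \in F).
  have [E|_] := eqVneq F F1; first by rewrite E (negPf aF1) in aF.
  have [E|_] := eqVneq F F2; first by rewrite E (negPf aF2) in aF.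
  by rewrite !mulr0 !addr0.
have [->|n1] := eqVneq F F1; first by rewrite (negPf F12n) mulr1 mulr0 addr0 add0r.
have [->|n2] := eqVneq F F2; first by rewrite mulr1 mulr0 !add0r.
by rewrite x0 ?mulr0 ?addr0 // tri_tented !inE (negPf aF) (negPf n1) (negPf n2) andbF.
Qed.

Lemma star_split E : star x E = star u E + r * (E \subset F1)%:R + s * (E \subset F2)%:R.
Proof. by rewrite -star_add; apply: eq_bigr => F _; exact: split_apex. Qed.

(** An extra face meets itself in three edges and the other one in none; only faces through [a]
    remain on the right. *)
Lemma extra_face : (q - 3) * r = edge_sum u F1 /\ (q - 3) * s = edge_sum u F2.
Proof.
have split F : edge_sum x F = edge_sum u F + r * common R F F1 + s * common R F F2.
  rewrite /edge_sum; under eq_bigr do rewrite star_split.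
  by rewrite !big_split /= -!mulr_sumr.
split; rewrite mulrBl xq ?tri_tented ?F13 ?F23 ?inE ?eqxx ?orbT // split.
  by rewrite common_self // common_eq0 //; ring.
by rewrite common_self // (@common_eq0 F2 F1) 1?setIC //; ring.
Qed.

Let eps v w := r * ([set v; w] \subset F1)%:R + s * ([set v; w] \subset F2)%:R.

Let r0 : 0 <= r. Proof. exact: x_ge0. Qed.
Let s0 : 0 <= s. Proof. exact: x_ge0. Qed.

Lemma eps_bounds v w : 0 <= eps v w <= r + s.
Proof.
rewrite /eps; have := r0; have := s0.
by case: (_ \subset F1); case: (_ \subset F2); rewrite /= ?mulr1 ?mulr0; lra.
Qed.

Lemma apex_eq v w : v != w -> v != a -> w != a ->
  q * U v w = S v + S w + U v w + eps v w.
Proof.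
move=> vw va wa; have F3 : #|[set a; v; w]| = 3%N by rewrite card_set3 // eq_sym.
rewrite /U xq; last by rewrite tri_tented F3 !inE !eqxx.
have [av aw] : a != v /\ a != w by rewrite !(eq_sym a).
rewrite /edge_sum sum_edges // (star_pair x3 av) (star_pair x3 aw) star_split (star_pair u3 vw).
rewrite /eps !addrA; congr (_ + _ + _); congr (_ + _).
rewrite (bigD1 a) //= big1 ?addr0 => [|z za].
  by rewrite /u !inE eqxx !orbT setUC setUA.
by apply: ua; rewrite !inE !negb_or av aw eq_sym.
Qed.

Let S_eq0 : S a = 0.
Proof. by rewrite /S big1 // => z _; apply: x3; rewrite setUid cards2; case: (a != z). Qed.

Let Udiag v : U v v = 0.
Proof. by apply: x3; rewrite -setUA setUid cards2; case: (a != v). Qed.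

Let Uapex v : U v a = 0.
Proof. by apply: x3; rewrite setUC setUA setUid cards2; case: (a != v). Qed.

(** Sum [apex_eq] over [w]. The main term on the right does not depend on [v], so all [S v] agree up
    to the contribution t of the extra faces. *)
Lemma spoke_eq v : v != a -> exists2 t, 0 <= t <= 3 * (r + s) &
  (q - n%:R + 2) * S v = \sum_w S w + t.
Proof.
move=> va; pose P w := (w != v) && (w != a).
have cut (f : 'I_n -> R) : \sum_w f w = f v + f a + \sum_(w | P w) f w.
  by rewrite (bigD1 v) //= (bigD1 a) 1?eq_sym //= addrA.
exists (\sum_(w | P w) eps v w).
  apply/andP; split.
    by apply: sumr_ge0 => w _; have /andP[] := eps_bounds v w.
  apply: (@le_trans _ _ (\sum_w (r * (w \in F1)%:R + s * (w \in F2)%:R))).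
    rewrite big_mkcond; apply: ler_sum => w _.
    have nn (B : bool) (p : R) : 0 <= p -> 0 <= p * B%:R by move=> p0; rewrite mulr_ge0 ?ler0n.
    case: (P w); last by rewrite addr_ge0 ?nn.
    apply: lerD; apply: ler_wpM2l => //; rewrite ler_nat subUset !sub1set.
      by case: (w \in F1); rewrite ?andbF //= leq_b1.
    by case: (w \in F2); rewrite ?andbF //= leq_b1.
  by rewrite big_split /= -!mulr_sumr !sum_indicator F13 F23; lra.
have h1 := cut (fun=> 1); rewrite sumr_const card_ord in h1.
have h2 := cut S; rewrite S_eq0 in h2.
have h3 : S v = \sum_(w | P w) U v w by rewrite [LHS](cut (U v)) Udiag Uapex !add0r.
have h4 : q * S v = \sum_(w | P w) (S v + S w + U v w + eps v w).
  rewrite h3 mulr_sumr; apply: eq_bigr => w /andP[wv wa].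
  by rewrite -h3 apex_eq // eq_sym.
move: h4; rewrite !big_split /= -h3.
have -> : \sum_(w | P w) S v = (n%:R - 2) * S v.
  rewrite (eq_bigr (fun w => S v * 1)) => [|w _]; last by rewrite mulr1.
  by rewrite -mulr_sumr mulrC; congr (_ * _); lra.
rewrite h2; lra.
Qed.

(** Subtracting two instances of [apex_eq] leaves differences of [S], at most (r + s)/100 each by
    [spoke_eq], and of [eps], at most r + s. *)
Lemma apex_values_close v w v' w' : v != w -> v != a -> w != a -> v' != w' -> v' != a -> w' != a ->
  (q - 1) * (U v w - U v' w') <= 2 * (r + s).
Proof.
move=> vw va wa vw' va' wa'.
have m1 : 1002 <= n%:R :> R by rewrite ler_nat.
have dS p p' : p != a -> p' != a -> S p - S p' <= (r + s) / 100.
  move=> pa pa'; have [t /andP[t0 t3] e1] := spoke_eq pa.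
  have [t' /andP[t0' t3'] e2] := spoke_eq pa'.
  apply: (@descale (q - n%:R + 2)); [by have := qn; lra|by rewrite addr_ge0|].
  by rewrite mulrBr e1 e2; have := r0; have := s0; lra.
have := dS _ _ va va'; have := dS _ _ wa wa'.
have := apex_eq vw va wa; have := apex_eq vw' va' wa'.
have /andP[e1 e2] := eps_bounds v w; have /andP[e1' e2'] := eps_bounds v' w'.
have := r0; have := s0.
move=> *; rewrite mulrBl mul1r mulrBr; lra.
Qed.

End Spread.

(** The difference is 2s(e3 - e2 + r): the new common edge earns 2rs, the change of position costs
    2s(e2 - e3). *)
Lemma gain_pos (A r s e1 e2 e3 : R) : 0 < s -> e2 - e3 < r ->
  A + 2 * r * e1 + 2 * s * e2 + 3 * r ^+ 2 + 3 * s ^+ 2 <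
  A + 2 * r * e1 + 2 * s * e3 + 3 * r ^+ 2 + 3 * s ^+ 2 + 2 * r * s * 1.
Proof.
move=> s0 er; rewrite -subr_gt0.
rewrite [X in 0 < X](_ : _ = 2 * (s * (e3 - e2 + r))); last by ring.
by rewrite !mulr_gt0 //; lra.
Qed.

(* The Perron vector, with its value at F2 moved to a face F3 adjacent to F1,
   is a test vector: the values at the faces through a are almost equal, so
   the gain 2 * x F1 * x F2 of the new adjacency dominates. *)
Theorem adjacent_improves a F1 F2 : (1002 <= n)%N -> #|F1| = 3%N -> #|F2| = 3%N ->
  a \notin F1 -> a \notin F2 -> (#|F1 :&: F2| <= 1)%N ->
  2 * n%:R - 3 < q1 R (tented a :|: [set F1; F2]) ->
  exists F3, [/\ #|F3| = 3%N, a \notin F3, #|F1 :&: F3| = 2%N &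
    q1 R (tented a :|: [set F1; F2]) < q1 R (tented a :|: [set F1; F3])].
Proof.
move=> n_big F13 F23 aF1 aF2 F12 qn.
have m1 : 1002 <= n%:R :> R by rewrite ler_nat.
have F12n : F1 != F2 by apply: contraTneq F12 => ->; rewrite setIid F23.
set K := tented a :|: [set F1; F2] in qn *; set q := q1 R K in qn *.
have sK : simplicial_complex K := simplicial_tented F13 F23 aF1 aF2.
have F1K : F1 \in tri K by rewrite tri_tented F13 !inE !eqxx orbT.
have [e _] := face_edge sK F1K.
have q0 : 0 < q1 R K by rewrite -/q; lra.
have [x [x_ge0 x0 [F0 xF0] xq]] := q1_perron sK e q0; rewrite -/q in xq.
have [b [c [d FE]]] := set3P F13; have [b' [c' [d' FE']]] := set3P F23.
have [bc bd cd] : [/\ b != c, b != d & c != d] by apply: set3_neq; rewrite -FE.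
have [bc' bd' cd'] : [/\ b' != c', b' != d' & c' != d'] by apply: set3_neq; rewrite -FE'.
have neqa F v : a \notin F -> v \in F -> v != a by move=> aF vF; apply: contraNneq aF => <-.
have [ba ca da] : [/\ b != a, c != a & d != a].
  by split; apply: (neqa F1) => //; rewrite FE !inE eqxx ?orbT.
have [ba' ca' da'] : [/\ b' != a, c' != a & d' != a].
  by split; apply: (neqa F2) => //; rewrite FE' !inE eqxx ?orbT.
have [p pF] : exists p, p \notin a |: F1.
  apply/existsP; rewrite -negb_forall; apply/negP => /forallP h.
  have : (#|'I_n| <= #|a |: F1|)%N by apply: subset_leq_card; apply/subsetP => v _; exact: h.
  by rewrite card_ord cardsU1 aF1 F13 => /(leq_trans n_big).
have [pa pb pc pd] : [/\ p != a, p != b, p != c & p != d].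
  by move: pF; rewrite FE !inE !negb_or => /andP[-> /andP[/andP[-> ->] ->]].
have [bp cp] : b != p /\ c != p by rewrite !(eq_sym _ p).
pose F3 := [set b; c; p].
have F33 : #|F3| = 3%N by exact: card_set3.
have aF3 : a \notin F3 by rewrite !inE !negb_or !(eq_sym a) ba ca pa.
have F13E : F1 :&: F3 = [set b; c].
  apply/setP => v; rewrite FE !inE; have [->|vd] := eqVneq v d.
    by rewrite !(eq_sym d) (negPf bd) (negPf cd) (negPf pd).
  by have [->|vp] := eqVneq v p; rewrite ?(negPf pb) ?(negPf pc) ?orbF ?andbb.
have F13n : F1 != F3.
  by apply/negP => /eqP E; have := F33; rewrite -[F3]setIid -{1}E F13E cards2 bc.
exists F3; split; [exact: F33|exact: aF3|by rewrite F13E cards2 bc|].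
pose U v w := x [set a; v; w]; pose u F := if a \in F then x F else 0.
pose r := x F1; pose s := x F2.
have [er es] := extra_face F13 F23 aF1 aF2 F12 x0 xq.
have sp := apex_values_close F13 F23 aF1 aF2 F12 x_ge0 x0 xq n_big qn.
have r0 : 0 <= r by exact: x_ge0.
have s0 : 0 <= s by exact: x_ge0.
have u3 F : #|F| != 3%N -> u F = 0.
  by move=> F3'; rewrite /u x0 ?if_same // inE (negPf F3') andbF.
have ua F : a \notin F -> u F = 0 by rewrite /u => /negPf ->.
have uU v w : u [set a; v; w] = U v w by rewrite /u !inE eqxx.
have T1 : edge_sum u F1 = U b c + U b d + U c d.
  by rewrite FE (edge_sum_cone ua u3) -?FE // !uU.
have T2 : edge_sum u F2 = U b' c' + U b' d' + U c' d'.
  by rewrite FE' (edge_sum_cone ua u3) -?FE' // !uU.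
have T3 : edge_sum u F3 = U b c + U b p + U c p.
  by rewrite (edge_sum_cone ua u3) // !uU.
have rs0 : 0 <= r + s by exact: addr_ge0.
have qb : 1000 <= q - 1 by clear -m1 qn; lra.
have qb' : 1000 <= q - 3 by clear -m1 qn; lra.
have d23 : edge_sum u F2 - edge_sum u F3 <= (r + s) / 100.
  by rewrite T2 T3; apply: (descale3 qb) => //; apply: sp.
have d21 : edge_sum u F2 - edge_sum u F1 <= (r + s) / 100.
  by rewrite T2 T1; apply: (descale3 qb) => //; apply: sp.
have d12 : edge_sum u F1 - edge_sum u F2 <= (r + s) / 100.
  by rewrite T2 T1; apply: (descale3 qb) => //; apply: sp.
(* The move costs at most a multiple of r + s, while the gain needs it below r alone; hence r and s
   must be comparable. *)
have sr : s - r <= (r + s) / 100 := descale_eq qb' rs0 er es d21.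
have rs : r - s <= (r + s) / 100 := descale_eq qb' rs0 es er d12.
(* If r = 0 then s = 0, so the values at faces through [a] all coincide; the equation at [F1] makes
   them 0, contradicting [xF0]. *)
have rp : 0 < r.
  rewrite ltNge; apply/negP => rle.
  have rz : r = 0 by apply/le_anti; rewrite rle.
  have sz : s = 0 by move: sr; rewrite rz; clear -s0; lra.
  have Uge v w : 0 <= U v w by exact: x_ge0.
  have Ubc : U b c = 0.
    have er0 : U b c + U b d + U c d = 0 by rewrite -T1 -er -/r rz mulr0.
    have h1 := Uge b c; have h2 := Uge b d; have h3 := Uge c d.
    by clear -er0 h1 h2 h3; lra.
  have Uz v w : v != w -> v != a -> w != a -> U v w = 0.
    move=> vw va wa; have := sp _ _ _ _ vw va wa bc ba ca.
    rewrite -/(U v w) -/(U b c) Ubc -/r -/s rz sz addr0 mulr0 subr0 pmulr_rle0.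
      by move=> Ule; apply/le_anti; rewrite Ule Uge.
    by clear -qb; lra.
  move: xF0; have [FK|/x0 ->] := boolP (F0 \in tri K); last by rewrite ltxx.
  move: FK; rewrite tri_tented // => /andP[/eqP F03 /orP[aF0|]].
    have [v [w F0E]] := set3_mem F03 aF0; rewrite F0E in F03 *.
    have [av aw vw] := set3_neq F03.
    by rewrite -/(U v w) Uz ?ltxx // eq_sym.
  by rewrite !inE => /orP[] /eqP ->; rewrite -/r -/s ?rz ?sz ltxx.
have sp0 : 0 < s by clear -rs rp; lra.
set q' := q1 R _.
pose y F := u F + r * (F == F1)%:R + s * (F == F3)%:R.
have sL : simplicial_complex (tented a :|: [set F1; F3]) := simplicial_tented F13 F33 aF1 aF3.
have F1L : F1 \in tri (tented a :|: [set F1; F3]) by rewrite tri_tented F13 !inE !eqxx orbT.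
have [e' _] := face_edge sL F1L.
have yL F : F \notin tri (tented a :|: [set F1; F3]) -> y F = 0.
  rewrite tri_tented // !inE /y.
  have [->|n1] := eqVneq F F1; first by rewrite F13 eqxx !orbT.
  have [->|n2] := eqVneq F F3; first by rewrite F33 eqxx !orbT.
  rewrite /= orbF negb_and !mulr0 !addr0 => /orP[] h; [exact: u3|exact: ua].
have := q1_rayleigh sL e' yL.
have [uF1 uF2 uF3] : [/\ u F1 = 0, u F2 = 0 & u F3 = 0] by split; exact: ua.
rewrite (sum_sqr_star u r s F13 F33) (sum_sqr_add r s F13n uF1 uF3) -/q'.
have -> : common R F1 F3 = 1.
  rewrite /common FE sum_edges // !subUset !sub1set !inE !eqxx ?orbT /=.
  rewrite !(eq_sym d) (negPf bd) (negPf cd) (negPf pd) /=; ring.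
have xE F : x F = u F + r * (F == F1)%:R + s * (F == F2)%:R.
  exact: (split_apex F23 aF1 aF2 F12 x0).
have X2 : \sum_F x F ^+ 2 = \sum_F u F ^+ 2 + r ^+ 2 + s ^+ 2.
  by under eq_bigr do rewrite xE; rewrite sum_sqr_add.
have Q2 : q * \sum_F x F ^+ 2 = \sum_(E : {set 'I_n} | #|E| == 2%N) star x E ^+ 2.
  under [RHS]eq_bigr do rewrite expr2.
  rewrite star_mul mulr_sumr; apply: eq_bigr => F _.
  have [FK|/x0 ->] := boolP (F \in tri K); last by rewrite expr0n mulr0 mul0r.
  by rewrite -xq // expr2; ring.
have Q3 : \sum_(E : {set 'I_n} | #|E| == 2%N) star x E ^+ 2 =
  \sum_(E : {set 'I_n} | #|E| == 2%N) star u E ^+ 2 + 2 * r * edge_sum u F1 + 2 * s * edge_sum u F2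
   + 3 * r ^+ 2 + 3 * s ^+ 2.
  transitivity (\sum_(E : {set 'I_n} | #|E| == 2%N)
    star (fun F => u F + r * (F == F1)%:R + s * (F == F2)%:R) E ^+ 2).
    by apply: eq_bigr => E _; congr (_ ^+ 2); apply: eq_bigr => F _; exact: xE.
  by rewrite sum_sqr_star // common_eq0 // mulr0 addr0.
rewrite -X2 ltNge => h; apply/negP => q'q.
have Y0 : 0 <= \sum_F x F ^+ 2 by apply: sumr_ge0 => F _; exact: sqr_ge0.
have := le_trans h (ler_wpM2r Y0 q'q); rewrite Q2 Q3 leNgt gain_pos //.
by clear -d23 sr rp; lra.
Qed.

End Final.

Theorem theorem4p4 (R : realType) :
  exists N : nat, forall n : nat, (N <= n)%N ->
    forall K : {set {set 'I_n}},
      K22 R K ->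
      (forall L : {set {set 'I_n}}, K22 R L -> q1 R L <= q1 R K) ->
      exists2 T : {set {set 'I_n}}, is_tented22 T & isomorphic K T.
Proof.
(* Finding the apex takes n >= 1000, the comparison of positions 1002. *)
exists 1002 => n n_big K HK Kmax.
have n5 i : (i < 5)%N -> (i < n)%N by move=> i5; apply: leq_trans n_big; apply: leq_trans i5 _.
pose v i (Hi : (i < 5)%N) := Ordinal (n5 i Hi).
have vE i j Hi Hj : (@v i Hi == @v j Hj) = (i == j) by [].
pose a0 := @v 0%N isT; pose G1 := [set @v 1%N isT; @v 2%N isT; @v 3%N isT].
pose G2 := [set @v 1%N isT; @v 2%N isT; @v 4%N isT].
have G13 : #|G1| = 3%N by rewrite card_set3.
have G23 : #|G2| = 3%N by rewrite card_set3.
have aG1 : a0 \notin G1 by rewrite !inE.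
have aG2 : a0 \notin G2 by rewrite !inE.
have G12 : G1 != G2.
  by apply/negP => /eqP/setP/(_ (@v 3%N isT)); rewrite !inE.
have qn : 2 * n%:R - 3 < q1 R K.
  apply: lt_le_trans (Kmax _ (tented_K22 R G13 G23 aG1 aG2 G12)).
  by apply: tented_q1_lower => //; apply: leq_trans n_big.
have [a full] := apex_of_large (leq_trans (isT : (1000 <= 1002)%N) n_big) HK qn.
have [F1 [F2 [F12 [F13 F23] [aF1 aF2] KE]]] := K22_shape HK full.
have [F2c|F2c] := leqP #|F1 :&: F2| 1; last first.
  (* [is_tented22] allows any apex and any adjacent pair, so [K] itself is the model and the
     identity the isomorphism. *)
  exists K; last by exists 1%g => F; rewrite (eq_imset _ (@perm1 _)) imset_id.
  have lt3 : (#|F1 :&: F2| < #|F1|)%N.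
    rewrite ltnNge; apply: contra F12 => h.
    have E : F1 :&: F2 = F1 by apply/eqP; rewrite eqEcard subsetIl h.
    by rewrite eqEcard -{1}E subsetIr F13 F23.
  rewrite F13 in lt3.
  by exists a, F1, F2; split => //; apply/eqP; rewrite eqn_leq F2c andbT.
rewrite KE in qn.
have [F3 [F33 aF3 F13c]] := adjacent_improves n_big F13 F23 aF1 aF2 F2c qn.
have F13n : F1 != F3 by apply/eqP => E; move: F13c; rewrite -E setIid F13.
by rewrite ltNge -KE Kmax //; exact: tented_K22.
Qed.
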